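(* For every $n\in\mathbb N$ let $(S_n(t))_{t\in\mathcal T_n}$ be a convex monotone semigroup on $C_\kappa(X_n)$. Suppose that: (1) For every $r,T\ge 0$ there exists $c\ge 0$ with $\|S_n(t)f-S_n(t)g\|_{\kappa,X_n}\le c\|f-g\|_{\kappa,X_n}$ for all $n\in\mathbb N$, $t\in[0,T]\cap\mathcal T_n$ and $f,g\in B_{C_\kappa(X_n)}(r)$. (2) For every $\epsilon>0$, $r,T\ge0$ and $K\Subset\mathbb R^d$ there exist $c\ge0$ and $K'\Subset\mathbb R^d$ with $\|S_n(t)f-S_n(t)g\|_{\infty,K_n}\le c\|f-g\|_{\infty,K'_n}+\epsilon$ for all $n\in\mathbb N$, $t\in[0,T]\cap\mathcal T_n$ and $f,g\in B_{C_\kappa(X_n)}(r)$. (3) There exist countable dense sets $\mathcal D_0\subset C_\kappa(\mathbb R^d)$ and $\mathcal T\subset\mathbb R_+$ such that for every $f\in\mathcal D_0$ there exist $\bar f_n\in C_\kappa(X_n)$ with $\bar f_n\to f$ and $\|\bar f_n\|_{\kappa,X_n}\le\|f\|_\kappa$ for all $n$ such that: there exist $t_n\in\mathcal T_n\setminus\{0\}$ with $\sup_n t_n<\infty$ and $\sup_{n}\sup_{t\in(0,t_n]\cap\mathcal T_n}\big\|\frac{S_n(t)\bar f_n-\bar f_n}{t}\big\|_{\kappa,X_n}<\infty$, and, for every $t\in\mathcal T$, there exist $\bar t_n\in\mathcal T_n$ with $\bar t_n\to t$ such that $(S_n(\bar t_n)\bar f_n)_{n\in\mathbb N}$ is uniformly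 equicontinuous. In addition, for every $f\in C_\kappa(\mathbb R^d)$ there exists $(f_n)_{n\in\mathbb N}\subset\mathcal D_0$ with $f_n\to f$ and $\|f_n\|_\kappa\le\|f\|_\kappa$ for all $n$. Then there exist a strongly continuous convex monotone semigroup $(S(t))_{t\ge0}$ on $C_\kappa(\mathbb R^d)$ with generator $A\colon D(A)\to C_\kappa(\mathbb R^d)$ and a subsequence $(n_l)_{l\in\mathbb N}\subset\mathbb N$ with $$S(t)f=\lim_{l\to\infty}S_{n_l}(t_{n_l})f_{n_l}\quad\text{for all }(f,t)\in C_\kappa(\mathbb R^d)\times\mathbb R_+,$$ where $t_n\in\mathcal T_n$ with $t_n\to t$ and $f_n\in C_\kappa(X_n)$ with $f_n\to f$ are arbitrary. In addition: (i) $\mathcal D_\infty\subset D(A)$. Moreover, for every $f\in\mathcal D_\infty$ and $K\Subset\mathbb R^d$, $\lim_{n\to\infty}\big\|\frac{S_n(h_n)f_n-f_n}{h_n}-Af\big\|_{\infty,K_n}=0$, where $(f_n)$ and $(h_n)$ are sequences as in the definition of $\mathcal D_\infty$ (for the given $f$ and $K$). (ii) For every $r,T\ge0$ there exists $c\ge0$ with $\|S(t)f-S(t)g\|_\kappa\le c\|f-g\|_\kappa$ for all $t\in[0,T]$ and $f,g\in B_{C_\kappa(\mathbb R^d)}(r)$. (iii) For every $\epsilon>0$, $r,T\ge0$ and $K\Subset\mathbb R^d$ there exist $c\ge0$ and $K'\Subset\mathbb R^d$ with $\|S(t)f-S(t)g\|_{\infty,K}\le c\|f-g\|_{\infty,K'}+\epsilon$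 for all $t\in[0,T]$ and $f,g\in B_{C_\kappa(\mathbb R^d)}(r)$.
   Context: Fix $d\in\mathbb N$ and a bounded continuous $\kappa:\mathbb R^d\to(0,\infty)$ with $\sup_{x\in\mathbb R^d}\sup_{|y|\le1}\kappa(x)/\kappa(x-y)<\infty$. For $X\subset\mathbb R^d$, $C_\kappa(X)$ is the space of continuous $f:X\to\mathbb R$ with $\|f\|_{\kappa,X}:=\sup_{x\in X}|f(x)|\kappa(x)<\infty$; $\|\cdot\|_\kappa:=\|\cdot\|_{\kappa,\mathbb R^d}$; $B_{C_\kappa(X)}(r):=\{f\in C_\kappa(X):\|f\|_{\kappa,X}\le r\}$; $\|f\|_{\infty,K}:=\sup_{x\in K}|f(x)|$; $K\Subset X$ means that $K$ is a compact subset of $X$. $C_\kappa(X)$ carries the mixed topology, the strongest locally convex topology coinciding on $\|\cdot\|_{\kappa,X}$-bounded sets with the topology of uniform convergence on compact subsets; for sequences, $f_n\to f$ iff $\sup_n\|f_n\|_{\kappa,X}<\infty$ and $\|f-f_n\|_{\infty,K}\to0$ for all $K\Subset X$. All limits (and density) in $C_\kappa(X)$ refer to this topology. $f\le g$ is pointwise, and $f_n\downarrow f$ means that $f_n$ decreases pointwise to $f$. An operator $S:C_\kappa(X)\to C_\kappa(X)$ is monotone if $f\le g$ implies $Sf\le Sg$, and convex if $S(\lambda f+(1-\lambda)g)\le\lambda Sf+(1-\lambda)Sg$ for $\lambda\in[0,1]$. For $f\in C_\kappa(\mathbb R^d)$, $Sf:=S(f|_X)$. $\mathbb R_+:=[0,\infty)$.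 Let $\mathcal T\subset\mathbb R_+$ with $0\in\mathcal T$ and $s+t\in\mathcal T$ for $s,t\in\mathcal T$. A convex monotone semigroup on $C_\kappa(X)$ is a family $(S(t))_{t\in\mathcal T}$ of operators $S(t):C_\kappa(X)\to C_\kappa(X)$ such that (a) each $S(t)$ is convex and monotone with $S(t)f_n\downarrow0$ whenever $f_n\downarrow0$; (b) $S(0)f=f$ and $S(s+t)f=S(s)S(t)f$; (c) $\sup_{t\in[0,T]\cap\mathcal T}\|S(t)\frac r\kappa\|_{\kappa,X}<\infty$ for all $r,T\ge0$. It is strongly continuous if $\mathcal T=\mathbb R_+$ and $\lim_{t\downarrow0}S(t)f=f$ for all $f$; then its generator is $Af:=\lim_{h\downarrow0}\frac{S(h)f-f}h$ with domain $D(A)$ the set of $f\in C_\kappa(X)$ for which this limit exists in $C_\kappa(X)$. Let $\mathcal T_n\subset\mathbb R_+$ and $X_n\subset\mathbb R^d$ ($n\in\mathbb N$) be such that for all $t\ge0$, $x\in\mathbb R^d$ there exist $t_n\in\mathcal T_n$, $x_n\in X_n$ with $t_n\to t$, $x_n\to x$; $s\pm t\in\mathcal T_n$ for all $s,t\in\mathcal T_n$ with $s\ge t$; $X_n$ is closed and $x+y\in X_n$ for all $x,y\in X_n$. For $K\Subset\mathbb R^d$ put $K_n:=K\cap X_n$. For $f_n\in C_\kappa(X_n)$ and $f\in C_\kappa(\mathbb R^d)$, $f_n\to f$ (or $f=\lim f_n$) means $\sup_n\|f_n\|_{\kappa,X_n}<\infty$ and $\|f-f_n\|_{\infty,K_n}\to0$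 for all $K\Subset\mathbb R^d$ with $K\cap X_n\ne\emptyset$ for all $n$ (similarly along subsequences). $(f_n)$ is uniformly equicontinuous if for every $\epsilon>0$ there is $\delta>0$ with $|f_n(x)-f_n(y)|<\epsilon$ for all $n$ and $x,y\in X_n$ with $|x-y|<\delta$. The asymptotic domain $\mathcal D_\infty$ of $(S_n)_{n\in\mathbb N}$ consists of all $f\in C_\kappa(\mathbb R^d)$ for which there exist $g\in C_\kappa(\mathbb R^d)$ and $f_n\in C_\kappa(X_n)$ with $f_n\to f$ such that: there exist $t_n\in\mathcal T_n\setminus\{0\}$ with $\sup_nt_n<\infty$ and $\sup_n\sup_{t\in(0,t_n]\cap\mathcal T_n}\|\frac{S_n(t)f_n-f_n}t\|_{\kappa,X_n}<\infty$; and for every $K\Subset\mathbb R^d$ there exist $h_n\in(0,t_n]\cap\mathcal T_n$ with $h_n\to0$ and $\lim_n\|\frac{S_n(h_n)f_n-f_n}{h_n}-g\|_{\infty,K_n}=0$. *)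

(* Defs.v *)
From HB Require Import structures.
From mathcomp Require Import all_boot all_order all_algebra.
From mathcomp Require Import all_classical all_reals all_analysis.

Set Implicit Arguments.
Unset Strict Implicit.
Unset Printing Implicit Defensive.

Import Order.TTheory GRing.Theory Num.Theory.
Import numFieldNormedType.Exports.

Local Open Scope classical_set_scope.
Local Open Scope ring_scope.

(* The library norm of ['rV[R]_d] is the maximum norm, which induces the same
   topology. *)
Definition enorm {R : realType} {d : nat} (x : 'rV[R]_d) : R :=
  Num.sqrt (\sum_(i < d) x ord0 i ^+ 2).

Record weight (R : realType) (d : nat) := Weight {
  weight_fun :> 'rV[R]_d -> R ;
  weight_gt0 : forall x, 0 < weight_fun x ;
  weight_continuous : continuous weight_fun ;
  weight_bounded : exists M, forall x, weight_fun x <= M ;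
  weight_ratio : exists C, forall x y,
    enorm y <= 1 -> weight_fun x / weight_fun (x - y) <= C }.

Section Ck_type.
Context {R : realType} {d : nat} (kappa : weight R d) (X : set 'rV[R]_d).

Definition Ck_mem : {pred X -> R} := fun f =>
  `[< continuous f /\
      exists C, forall x : X, `|f x| * kappa (set_val x) <= C >].

Lemma Ck_memP f : f \in Ck_mem <->
  continuous f /\ exists C, forall x : X, `|f x| * kappa (set_val x) <= C.
Proof. by rewrite unfold_in; split => /asboolP. Qed.

Lemma Ck_mem_submod : submod_closed Ck_mem.
Proof.
split.
  apply/Ck_memP; split; first by move=> x; exact: (@cst_continuous _ _ (0 : R)).
  by exists 0 => x; rewrite normr0 mul0r.
move=> a f g /Ck_memP[cf [Cf fC]] /Ck_memP[cg [Cg gC]]; apply/Ck_memP; split.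
  move=> x; apply: (@continuousD R R X (a *: f) g); last exact: cg.
  by apply: (@continuousM R X (cst a) f); [exact: cst_continuous|exact: cf].
exists (`|a| * Cf + Cg) => x.
have k0 := ltW (weight_gt0 kappa (set_val x)).
apply: (@le_trans _ _ ((`|a| * `|f x| + `|g x|) * kappa (set_val x))).
  by apply: ler_wpM2r => //; rewrite -normrM; exact: ler_normD.
by rewrite mulrDl -mulrA lerD// ler_wpM2l.
Qed.

HB.instance Definition _ := GRing.isSubmodClosed.Build R (X -> R) Ck_mem
  Ck_mem_submod.

Record Ck := CkFun { Ck_fun :> X -> R ; Ck_funP : Ck_fun \in Ck_mem }.

HB.instance Definition _ := [isSub for Ck_fun].
HB.instance Definition _ := [Choice of Ck by <:].
HB.instance Definition _ := [SubChoice_isSubLmodule of Ck by <:].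
HB.instance Definition _ := isPointed.Build Ck 0.

(* The suprema are taken in [R] with [sup set0 = 0]. *)
Definition wnorm (f : Ck) : R :=
  sup [set `|f x| * kappa (set_val x) | x in [set: X]].

Definition unorm (K : set 'rV[R]_d) (f : Ck) : R :=
  sup [set `|f x| | x in [set x : X | K (set_val x)]].

Definition wball (r : R) : set Ck := [set f | wnorm f <= r].

Definition compact_cvg_open : set_system Ck :=
  [set [set f : Ck | W (Ck_fun f)] |
     W in [set W : set {family compact, X -> R} | open W]].

Definition same_trace (O1 O2 : set_system Ck) (B : set Ck) :=
  forall U : set Ck, (exists2 V, O1 V & B `&` U = B `&` V) <->
                     (exists2 V, O2 V & B `&` U = B `&` V).

(* A locally convex topology on [Ck] is given by its transport along a linear
   bijection onto a locally convex space. *)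
Definition mixed_subbase : set (set Ck) :=
  [set U | exists (E : tvsType R) (phi : {linear Ck -> E}),
     let O := [set phi @^-1` V | V in [set V : set E | open V]] in
     [/\ bijective phi,
         forall B : set Ck, (exists r, B `<=` wball r) ->
           same_trace O compact_cvg_open B
       & O U]].

(* The mixed topology: the supremum of all the locally convex topologies that
   agree on norm-bounded sets with uniform convergence on compact subsets. This
   supremum is one of them, hence the strongest. *)
HB.instance Definition _ :=
  @isSubBaseTopological.Build Ck (set Ck) mixed_subbase id.

Lemma divr_weight_mem (r : R) :
  (fun x : X => r / kappa (set_val x)) \in Ck_mem.
Proof.
apply/Ck_memP; split.
  move=> x; apply: (@continuousM R X (cst r) (fun x => (kappa (set_val x))^-1)).
    exact: cst_continuous.
  apply: continuousV; first by rewrite gt_eqF// weight_gt0.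
  apply: (@continuous_comp X _ _ set_val kappa); first exact: initial_continuous.
  exact: weight_continuous.
exists `|r| => x; have k0 := weight_gt0 kappa (set_val x).
by rewrite normrM normfV (gtr0_norm k0) divfK// gt_eqF.
Qed.

Definition divr_weight (r : R) : Ck := CkFun (divr_weight_mem r).

Definition decreases_to (f_ : nat -> Ck) (f : Ck) :=
  forall x, nonincreasing_seq (fun n => f_ n x) /\
            f_ n x @[n --> \oo] --> f x.

Definition monotone_op (S : Ck -> Ck) :=
  forall f g : Ck, (forall x, f x <= g x) -> forall x, S f x <= S g x.

Definition convex_op (S : Ck -> Ck) :=
  forall (a : R) (f g : Ck), 0 <= a <= 1 ->
    forall x, S (a *: f + (1 - a) *: g) x <= a * S f x + (1 - a) * S g x.

Record convex_monotone_semigroup (T : set R) (S : R -> Ck -> Ck) : Prop := {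
  cms_time_ge0 : forall t, T t -> 0 <= t ;
  cms_time0 : T 0 ;
  cms_timeD : forall s t, T s -> T t -> T (s + t) ;
  cms_convex : forall t, T t -> convex_op (S t) ;
  cms_monotone : forall t, T t -> monotone_op (S t) ;
  cms_decr : forall t, T t -> forall f_, decreases_to f_ 0 ->
    decreases_to (fun n => S t (f_ n)) 0 ;
  cms_0 : forall f, S 0 f = f ;
  cms_D : forall s t, T s -> T t -> forall f, S (s + t) f = S s (S t f) ;
  cms_bounded : forall r T0, 0 <= r -> 0 <= T0 -> exists C,
    forall t, T t -> 0 <= t <= T0 -> wnorm (S t (divr_weight r)) <= C }.

Definition diff_quot (S : R -> Ck -> Ck) (h : R) (f : Ck) : Ck :=
  h^-1 *: (S h f - f).

Definition strongly_continuous (S : R -> Ck -> Ck) :=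
  forall f, S t f @[t --> 0^'+] --> f.

Definition generator_dom (S : R -> Ck -> Ck) : set Ck :=
  [set f | cvg (diff_quot S h f @[h --> 0^'+])].

Definition generator (S : R -> Ck -> Ck) (f : Ck) : Ck :=
  lim (diff_quot S h f @[h --> 0^'+]).

End Ck_type.

Arguments Ck_mem {R d} kappa X f.
Arguments wball {R d kappa X} r f.

Section restriction.
Context {R : realType} {d : nat} {kappa : weight R d}.

Lemma restr_mem (X : set 'rV[R]_d) (f : Ck kappa setT) :
  (fun x : X => f (SigSub (in_setT (set_val x)))) \in Ck_mem kappa X.
Proof.
have /Ck_memP[cf [C fC]] := Ck_funP f; apply/Ck_memP; split; last first.
  by exists C => x; exact: fC.
move=> x; apply: (@continuous_comp X [set: 'rV[R]_d] _
  (fun x : X => SigSub (in_setT (set_val x))) f); last exact: cf.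
move=> U [V [[W oW <-] /= Wx VU]]; exists (set_val @^-1` W); split => //.
  by exists W.
by move=> y /= Wy; exact: VU.
Qed.

Definition restr (X : set 'rV[R]_d) (f : Ck kappa setT) : Ck kappa X :=
  CkFun (restr_mem X f).

(* Also used for subsequences, with [X := X_ \o nu]. *)
Definition Ck_cvg (X : nat -> set 'rV[R]_d)
    (f_ : forall n, Ck kappa (X n)) (f : Ck kappa setT) :=
  (exists C, forall n, wnorm (f_ n) <= C) /\
  forall K, compact K -> (forall n, K `&` X n !=set0) ->
    unorm K (restr (X n) f - f_ n) @[n --> \oo] --> (0 : R).

Definition uniformly_equicontinuous (X : nat -> set 'rV[R]_d)
    (f_ : forall n, Ck kappa (X n)) :=
  forall e : R, 0 < e -> exists2 delta : R, 0 < delta &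
    forall n (x y : X n), enorm (set_val x - set_val y) < delta ->
      `|f_ n x - f_ n y| < e.

Section asymptotic_domain.
Variables (X : nat -> set 'rV[R]_d) (T : nat -> set R).
Variable S : forall n, R -> Ck kappa (X n) -> Ck kappa (X n).
Arguments S : clear implicits.

Definition bounded_rate (f_ : forall n, Ck kappa (X n)) (t_ : nat -> R) :=
  [/\ forall n, T n (t_ n) /\ t_ n != 0,
      exists C, forall n, t_ n <= C
    & exists C, forall n t, T n t -> 0 < t <= t_ n ->
        wnorm (diff_quot (S n) t (f_ n)) <= C].

Definition rate_sequence (g : Ck kappa setT) (f_ : forall n, Ck kappa (X n))
    (t_ : nat -> R) (K : set 'rV[R]_d) (h_ : nat -> R) :=
  [/\ forall n, T n (h_ n) /\ 0 < h_ n <= t_ n,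
      h_ n @[n --> \oo] --> (0 : R)
    & unorm K (diff_quot (S n) (h_ n) (f_ n) - restr (X n) g)
        @[n --> \oo] --> (0 : R)].

Definition asymptotic_witness (f g : Ck kappa setT)
    (f_ : forall n, Ck kappa (X n)) (t_ : nat -> R) :=
  [/\ Ck_cvg f_ f, bounded_rate f_ t_
    & forall K, compact K -> exists h_, rate_sequence g f_ t_ K h_].

Definition asymptotic_domain : set (Ck kappa setT) :=
  [set f | exists g f_ t_, asymptotic_witness f g f_ t_].

End asymptotic_domain.
End restriction.

(* Main.v *)
Require Import Defs.
From HB Require Import structures.
From mathcomp Require Import finmap.
From mathcomp Require Import all_boot all_order all_algebra.
From mathcomp Require Import all_classical all_reals all_analysis.
From mathcomp Require Import ring lra.

Set Implicit Arguments.
Unset Strict Implicit.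
Unset Printing Implicit Defensive.

Import Order.TTheory GRing.Theory Num.Theory.
Import numFieldNormedType.Exports.

Local Open Scope classical_set_scope.
Local Open Scope ring_scope.

(** The values [S_ n s f x] are compared along samples, that is triples of an
    index [n], a time [s] in [T n] and a point [x] in [X n]. For each [(t, x)] the
    filter [samples_at t x] collects the samples with [n] large, [s] near [t] and
    the point near [x]. By [samples_cvg] and [Ck_cvg_samples], convergence on the
    varying domains is, for bounded sequences, the same as convergence of one
    real function along all these filters. A limit along the samples is jointly
    continuous in time and space, since nearby limit points share their samples
    ([samples_lim_continuous]). So the semigroup is found as soon as [S_ n s f x]
    converges along all the filters [samples_at t x], for a subsequence of the
    systems.

    Existence of the limit. For [f] in [D0], the bound on the difference quotients
    at short times spreads to all bounded times by the semigroup law and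
    hypothesis (1), which makes the approximations Lipschitz in time, uniformly in
    [n] ([rate_extends], [rate_lipschitz]). They are equicontinuous in space at the
    times of [Q]. Hence it suffices that they converge for countably many [f],
    times in [Q] and rational vectors ([anchored_cvg]), and a diagonal argument
    provides a subsequence for which they do ([diagonal_subsequence]). Hypothesis
    (2), continuity for locally uniform convergence on bounded sets with constants
    independent of [n], extends the convergence from [D0] to all [f]
    ([anchored_dense_cvg]).

    Properties of the limit. Convexity, monotonicity, the semigroup law and the
    estimates (ii) and (iii) pass to the limit. Continuity from above follows from
    (iii) by Dini's theorem, and strong continuity is joint continuity at time [0].

    The generator. For [f] in the asymptotic domain write [S_n (k h) f - f] as the
    sum of the increments [S_n (i h) (f + h G) - S_n (i h) f], where [G] is the
    difference quotient of [f_ n] for the step [h]. By convexity such an increment,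
    divided by [h], lies between [S_n (i h) f - S_n (i h) (f - G)] and
    [S_n (i h) (f + G) - S_n (i h) f]. For small times both are close to [g], since
    [G] is close to [g] on the compact set that hypothesis (2) asks for. Summing up
    and letting [n] tend to infinity, [S (t) f - f - t g] is locally uniformly
    [o(t)] ([asymptotic_expansion]).

    The mixed topology. The limits that occur are taken on bounded sets, where
    it agrees with locally uniform convergence. One direction is its definition
    ([mixed_cvg_of_bounded]). For the other, the norm [sup |f| kappa / (1 + |x|)]
    induces one of the topologies whose supremum is the mixed topology
    ([damped_same_trace]), so that compact-open sets are open in it
    ([compact_open_mixed]); in particular limits are unique and the generator is
    determined by any limit of the difference quotients. *)

(** * Weighted and local suprema *)

Section norms.
Context {R : realType} {d : nat} {kappa : weight R d}.

Lemma weight_lb (K : set 'rV[R]_d) : compact K ->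
  exists2 m : R, 0 < m & forall x, K x -> m <= kappa x.
Proof.
move=> cK; have [->|/set0P K0] := eqVneq K set0; first by exists 1.
have [|c cK' cmin] := compact_EVT_min K0 cK (f := kappa).
  by apply: continuous_subspaceT => x; exact: weight_continuous.
exists (kappa c); first exact: weight_gt0.
by move=> x Kx; apply: cmin; rewrite inE.
Qed.

Definition cball (r : R) : set 'rV[R]_d := [set x | `|x| <= r].

Lemma cball_compact r : compact (cball r).
Proof.
apply: bounded_closed_compact.
  exists r; split; first exact: num_real.
  by move=> M rM x /= xr; rewrite (le_trans xr)// ltW.
have -> : cball r = (fun x : 'rV[R]_d => `|x|) @^-1` [set y | y <= r] by [].
by apply: closed_comp; [move=> x _; exact: norm_continuous|exact: closed_le].
Qed.

Lemma compact_cball (K : set 'rV[R]_d) : compact K ->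
  exists2 r, 0 <= r & K `<=` cball r.
Proof.
move=> /compact_bounded[M [Mr HM]]; exists (`|M| + 1); first exact: addr_ge0.
by move=> x Kx; apply: HM => //; rewrite (le_lt_trans (ler_norm M))// ltrDl.
Qed.

Section fixed_domain.
Context {X : set 'rV[R]_d}.
Implicit Types (f g : Ck kappa X) (K : set 'rV[R]_d).

Lemma wnorm_ub f (x : X) : `|f x| * kappa (set_val x) <= wnorm f.
Proof.
apply: ub_le_sup; last by exists x.
have /Ck_memP[_ [C fC]] := Ck_funP f.
by exists C => _ [y _ <-]; exact: fC.
Qed.

Lemma wnorm_le f (C : R) : 0 <= C ->
  (forall x : X, `|f x| * kappa (set_val x) <= C) -> wnorm f <= C.
Proof.
move=> C0 fC; rewrite /wnorm; set A := (X in sup X).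
have [->|/set0P A0] := eqVneq A set0; first by rewrite sup0.
by apply: ge_sup => // _ [x _ <-].
Qed.

Lemma wnorm_ge0 f : 0 <= wnorm f.
Proof.
rewrite /wnorm; set A := (X in sup X).
have [->|/set0P [_ [x _ _]]] := eqVneq A set0; first by rewrite sup0.
by apply: le_trans (wnorm_ub f x); rewrite mulr_ge0// ltW// weight_gt0.
Qed.

Lemma wnorm_pt f (x : X) : `|f x| <= wnorm f / kappa (set_val x).
Proof. by rewrite ler_pdivlMr ?weight_gt0//; exact: wnorm_ub. Qed.

Lemma compact_wnorm K : compact K -> exists2 M : R, 0 < M &
  forall f (x : X), K (set_val x) -> `|f x| <= M * wnorm f.
Proof.
move=> /weight_lb[m m0 Km]; exists m^-1; first by rewrite invr_gt0.
move=> f x Kx; apply: le_trans (wnorm_pt f x) _.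
by rewrite mulrC ler_wpM2r ?wnorm_ge0// lef_pV2 ?posrE ?weight_gt0//; exact: Km.
Qed.

Lemma unorm_ub K f (x : X) : compact K -> K (set_val x) -> `|f x| <= unorm K f.
Proof.
move=> /compact_wnorm[M M0 KM] Kx; apply: ub_le_sup; last by exists x.
by exists (M * wnorm f) => _ [y Ky <-]; exact: KM.
Qed.

Lemma unorm_le K f (C : R) : 0 <= C ->
  (forall x : X, K (set_val x) -> `|f x| <= C) -> unorm K f <= C.
Proof.
move=> C0 fC; rewrite /unorm; set A := (X in sup X).
have [->|/set0P A0] := eqVneq A set0; first by rewrite sup0.
by apply: ge_sup => // _ [x Kx <-]; exact: fC.
Qed.

Lemma unorm_ge0 K f : compact K -> 0 <= unorm K f.
Proof.
move=> cK; rewrite /unorm; set A := (X in sup X).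
have [->|/set0P [_ [x Kx _]]] := eqVneq A set0; first by rewrite sup0.
exact: le_trans (unorm_ub f cK Kx).
Qed.

Lemma unorm_sub K K' f : compact K' -> K `<=` K' -> unorm K f <= unorm K' f.
Proof.
move=> cK' KK'; apply: unorm_le; first exact: unorm_ge0.
by move=> x /KK' ?; exact: unorm_ub.
Qed.

Lemma CkP f g : (forall x, f x = g x) -> f = g.
Proof. by move=> fg; apply/val_inj/funext. Qed.

Lemma CkDE f g (x : X) : (f + g) x = f x + g x. Proof. by []. Qed.
Lemma CkBE f g (x : X) : (f - g) x = f x - g x. Proof. by []. Qed.
Lemma CkNE f (x : X) : (- f) x = - f x. Proof. by []. Qed.
Lemma CkZE a f (x : X) : (a *: f) x = a * f x. Proof. by []. Qed.
Lemma Ck0E (x : X) : (0 : Ck kappa X) x = 0. Proof. by []. Qed.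
Definition CkE := (CkDE, CkNE, CkZE, Ck0E).

Lemma wnormD f g : wnorm (f + g) <= wnorm f + wnorm g.
Proof.
apply: wnorm_le => [|x]; first by rewrite addr_ge0 ?wnorm_ge0.
apply: le_trans (lerD (wnorm_ub f x) (wnorm_ub g x)).
by rewrite -mulrDl ler_wpM2r ?ler_normD// (ltW (weight_gt0 _ _)).
Qed.

Lemma wnormN f : wnorm (- f) = wnorm f.
Proof.
suff H g : wnorm (- g) <= wnorm g.
  by apply/eqP; rewrite eq_le H -{1}(opprK f) H.
apply: wnorm_le => [|x]; first exact: wnorm_ge0.
by rewrite CkE normrN wnorm_ub.
Qed.

Lemma wnormB f g : wnorm (f - g) <= wnorm f + wnorm g.
Proof. by rewrite -(wnormN g) wnormD. Qed.

Lemma unormD K f g : compact K -> unorm K (f + g) <= unorm K f + unorm K g.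
Proof.
move=> cK; apply: unorm_le => [|x Kx]; first by rewrite addr_ge0 ?unorm_ge0.
by rewrite CkE (le_trans (ler_normD _ _))// lerD// unorm_ub.
Qed.

Lemma unormN K f : unorm K (- f) = unorm K f.
Proof.
rewrite /unorm; congr sup; apply/seteqP; split => _ [x Kx <-]; exists x => //;
  by rewrite CkE normrN.
Qed.

End fixed_domain.

(** A function in [Ck kappa setT] takes arguments in the subtype of [setT]; [pt]
    lets it be evaluated at vectors. *)
Definition pt (x : 'rV[R]_d) : [set: 'rV[R]_d] := SigSub (in_setT x).

Lemma ptK (x : [set: 'rV[R]_d]) : pt (set_val x) = x.
Proof. exact: val_inj. Qed.

Lemma pt_continuous : continuous pt.
Proof.
move=> x U [V [[W oW <-] /= Wx VU]].
by apply: (@filterS _ _ _ W) => [y Wy|]; [exact: VU|exact: open_nbhs_nbhs].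
Qed.

Implicit Types (f g : Ck kappa setT) (X : set 'rV[R]_d).

Lemma Ck_continuous f : continuous (fun x => f (pt x)).
Proof.
have /Ck_memP[cf _] := Ck_funP f.
by move=> x; apply: (continuous_comp (pt_continuous (x:=x))); exact: cf.
Qed.

Lemma Ck_build (g : 'rV[R]_d -> R) : continuous g ->
  (exists C, forall x, `|g x| * kappa x <= C) ->
  exists f : Ck kappa setT, forall x, f (pt x) = g x.
Proof.
move=> cg [C gC].
have P : (fun x : [set: 'rV[R]_d] => g (set_val x)) \in Ck_mem kappa setT.
  apply/Ck_memP; split; last by exists C => x; exact: gC.
  move=> x; apply: (@continuous_comp _ _ _ set_val g); last exact: cg.
  exact: initial_continuous.
by exists (CkFun P).
Qed.

Lemma restrE X f (x : X) : restr X f x = f (pt (set_val x)).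
Proof. by []. Qed.

Lemma restrB X f g : restr X (f - g) = restr X f - restr X g.
Proof. exact: CkP. Qed.

Lemma wnorm_restr X f : wnorm (restr X f) <= wnorm f.
Proof.
by apply: wnorm_le => [|x]; [exact: wnorm_ge0|exact: (wnorm_ub f (pt _))].
Qed.

Lemma unorm_restr X K f : compact K -> unorm K (restr X f) <= unorm K f.
Proof.
move=> cK; apply: unorm_le => [|x Kx]; first exact: unorm_ge0.
exact: (unorm_ub f (x := pt _) cK).
Qed.

(** [Ck_cvg] only tests compact sets that meet every [X n]. Every compact
    set lies in a ball that also contains a convergent sequence of points of the
    [X n], so the test passes on all compact sets. *)
Lemma Ck_cvg_compact (X : nat -> set 'rV[R]_d) (f_ : forall n, Ck kappa (X n)) f
    (K : set 'rV[R]_d) :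
  (exists2 x_ : nat -> 'rV[R]_d, forall n, X n (x_ n) & cvg (x_ n @[n --> \oo])) ->
  Ck_cvg f_ f -> compact K ->
  unorm K (restr (X n) f - f_ n) @[n --> \oo] --> (0 : R).
Proof.
move=> [x_ Xx /cvg_seq_bounded[M [_ xM]]] [_ fcvg] cK.
have [r r0 Kr] := compact_cball cK.
set r' := r + (`|M| + 1).
have K'cvg := fcvg (cball r') (cball_compact (r := r')).
apply: (squeeze_cvgr _ (cvg_cst 0) (K'cvg _)); last first.
  move=> n; exists (x_ n); split => //.
  rewrite /cball /= (le_trans (xM (`|M| + 1) _ n _))//.
    by rewrite (le_lt_trans (ler_norm M))// ltrDl.
  by rewrite lerDr.
apply: nearW => n; rewrite unorm_ge0//= unorm_sub//; first exact: cball_compact.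
by move=> x /Kr /le_trans; apply; rewrite lerDl.
Qed.

End norms.

(** * The mixed topology on bounded sets *)

Section mixed_topology.
Context {R : realType} {d : nat} {kappa : weight R d}.

Definition compact_close (X : set 'rV[R]_d) K (e : R) (f : Ck kappa X) :
    set (Ck kappa X) :=
  [set g | forall x : X, K (set_val x) -> `|g x - f x| < e].

Lemma compact_open_cvg (X : set 'rV[R]_d) (F : set_system (Ck kappa X))
    (f : Ck kappa X) : Filter F ->
  (forall K (e : R), compact K -> 0 < e ->
    F (compact_close K e f)) ->
  (fmap (@Ck_fun _ _ kappa X) F : set_system (X -> R)) -->
    (Ck_fun f : {family compact, X -> R}).
Proof.
move=> FF Fcvg; apply/fam_cvgP => A cA U /uniform_nbhs[E [entE EU]].
have [e /= e0 eE] : exists2 e : R, 0 < e & [set xy : R * R | ball xy.1 e xy.2] `<=` E.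
  by move: entE; rewrite -entourage_ballE => -[e e0 eE]; exists e.
have cK : compact (set_val @` A).
  by apply: continuous_compact cA; apply: continuous_subspaceT => x;
    exact: initial_continuous.
have := Fcvg _ _ cK e0; rewrite /fmap /= !nbhs_simpl /=.
apply: filterS => g gf; apply: EU => x Ax; apply: eE => /=.
by rewrite /ball /= distrC gf//; exists x.
Qed.

(** On the ball that contains both the filter and its limit, each of the
    topologies whose supremum is the mixed one leaves the same trace as the
    compact-open topology, for which the convergence is assumed. *)
Lemma mixed_cvg_of_bounded (X : set 'rV[R]_d) (F : set_system (Ck kappa X))
    (f : Ck kappa X) (r : R) : Filter F ->
  F (wball r) ->
  (forall K (e : R), compact K -> 0 < e ->
    F (compact_close K e f)) ->
  F --> f.
Proof.
move=> FF Fr Fcvg A /=; rewrite nbhsE.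
move=> [_ [[B sB <-] [C BC Cf]] sUBA].
rewrite nbhs_filterE; apply: filterS sUBA _; apply: (@filterS _ _ _ C).
  by move=> ? ?; exists C.
have /sB [D sD IDeC] := BC; rewrite -IDeC; apply: filter_bigI => U DU.
have /sD := DU; rewrite inE => -[E [phi /= [_ tr OU]]].
have Uf : U f by move: Cf; rewrite -IDeC => /(_ _ DU).
pose r' := Num.max r (wnorm f).
have [//||V' [W /= oW <-] UV'] := (tr (wball r') _ U).1; first by exists r'.
  by exists U.
have Bf : wball r' f by rewrite /wball /= le_max lexx orbT.
have [_ Wf] : (wball r' `&` [set g : Ck kappa X | W (Ck_fun g)]) f.
  by rewrite -UV'.
have FW : F [set g | W (Ck_fun g)].
  exact: (compact_open_cvg FF Fcvg (open_nbhs_nbhs (conj oW Wf))).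
apply: filterS (filterI Fr FW) => g [gr Wg].
suff : (wball r' `&` U) g by case.
by rewrite UV'; split => //; rewrite /wball /= le_max gr.
Qed.

Lemma mixed_subbase_open (X : set 'rV[R]_d) (U : set (Ck kappa X)) :
  mixed_subbase U -> open U.
Proof.
move=> mU; exists [set U]; last first.
  by rewrite predeqE => ?; split=> [[_ ->]|] //; exists U.
move=> _ ->; exists [fset U]%fset; first by move=> ? /fset1P->; rewrite inE.
by rewrite predeqE => g; split=> [|Ug V /fset1P->//]; apply; exact: fset11.
Qed.

End mixed_topology.

(** A copy of the space for the norm below. Dividing the weight by [1 + `|x|]
    makes the tails of a bounded set of functions uniformly small, so that this
    norm induces locally uniform convergence there, and its topology is one of
    those whose supremum is the mixed topology. *)
Definition dampedCk {R : realType} {d : nat} (kappa : weight R d) :=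
  Ck kappa [set: 'rV[R]_d].

Section damped.
Context {R : realType} {d : nat} {kappa : weight R d}.
Notation D := (dampedCk kappa).
HB.instance Definition _ := Choice.copy D (Ck kappa setT).
HB.instance Definition _ := GRing.Lmodule.copy D (Ck kappa setT).

Definition damped_weight (x : 'rV[R]_d) : R := kappa x / (1 + `|x|).

Let w_gt0 x : 0 < damped_weight x.
Proof. by rewrite divr_gt0 ?weight_gt0// ltr_pwDl. Qed.

Let w_le x : damped_weight x <= kappa x.
Proof.
rewrite ler_pdivrMr ?ltr_pwDl// ler_peMr ?(ltW (weight_gt0 _ _))//.
by rewrite lerDl.
Qed.

Definition damped_norm (f : D) : R :=
  sup [set `|(f : Ck kappa setT) x| * damped_weight (set_val x) | x in setT].

Lemma damped_norm_ub (f : D) x :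
  `|(f : Ck kappa setT) x| * damped_weight (set_val x) <= damped_norm f.
Proof.
apply: ub_le_sup; last by exists x.
exists (wnorm (f : Ck kappa setT)) => _ [y _ <-].
by apply: le_trans (wnorm_ub _ y); rewrite ler_wpM2l.
Qed.

Lemma damped_norm_le (f : D) (C : R) :
  (forall x, `|(f : Ck kappa setT) x| * damped_weight (set_val x) <= C) ->
  damped_norm f <= C.
Proof.
move=> fC; apply: ge_sup => [|_ [x _ <-]//].
by exists (`|(f : Ck kappa setT) (pt 0)| * damped_weight 0); exists (pt 0).
Qed.

Lemma damped_normD (f g : D) : damped_norm (f + g) <= damped_norm f + damped_norm g.
Proof.
apply: damped_norm_le => x.
apply: le_trans (lerD (damped_norm_ub f x) (damped_norm_ub g x)).
by rewrite -mulrDl ler_wpM2r ?(ltW (w_gt0 _))//; exact: ler_normD.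
Qed.

Lemma damped_normZ (a : R) (f : D) : damped_norm (a *: f) = `|a| * damped_norm f.
Proof.
have H b (g : D) : damped_norm (b *: g) <= `|b| * damped_norm g.
  apply: damped_norm_le => x.
  rewrite (_ : `|_| = `|b| * `|(g : Ck kappa setT) x|) -?mulrA; last exact: normrM.
  by rewrite ler_wpM2l// damped_norm_ub.
apply/eqP; rewrite eq_le H /=; have [->|a0] := eqVneq a 0.
  rewrite normr0 mul0r; apply: le_trans (damped_norm_ub _ (pt 0)).
  by rewrite mulr_ge0// ltW.
by rewrite -ler_pdivlMl ?normr_gt0// -normfV -{1}[f](scalerK a0) H.
Qed.

Lemma damped_norm0_eq0 (f : D) : damped_norm f = 0 -> f = 0.
Proof.
move=> f0; apply: CkP => x; apply/eqP; rewrite -normr_eq0 -[_ == 0]orbF.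
rewrite -(gt_eqF (w_gt0 (set_val x))) -mulf_eq0 eq_le mulr_ge0 ?(ltW (w_gt0 _))//.
by rewrite andbT -f0 damped_norm_ub.
Qed.

HB.instance Definition _ := Lmodule_isNormed.Build R D
  damped_normD damped_normZ damped_norm0_eq0.

Definition to_damped (f : Ck kappa setT) : D := f.

Lemma to_damped_linear : linear to_damped. Proof. by []. Qed.

HB.instance Definition _ :=
  GRing.isLinear.Build R (Ck kappa setT) D *:%R to_damped to_damped_linear.

Let O_ := [set to_damped @^-1` V | V in [set V : set D | open V]].

(** On a compact set the damped weight is bounded below, so the damped norm
    controls the uniform norm. *)
Lemma damped_compact_open (W : set {family compact, [set: 'rV[R]_d] -> R}) :
  open W -> open ([set f | W (Ck_fun f)] : set D).
Proof.
move=> oW; rewrite openE => f /= Wf.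
suff Fcvg K (e : R) : compact K -> 0 < e ->
    nbhs (f : D) (compact_close K e (f : Ck kappa setT)).
  have FF : Filter (nbhs (f : D)) by exact: nbhs_filter.
  exact: (compact_open_cvg FF Fcvg (open_nbhs_nbhs (conj oW Wf))).
move=> cK e0.
have [m m0 Km] := weight_lb (kappa := kappa) cK; have [r r0 Kr] := compact_cball cK.
have c0 : 0 < m / (1 + r) by rewrite divr_gt0// ltr_pwDl.
apply/(@nbhs_normP _ D f); exists (e * (m / (1 + r))); first exact: mulr_gt0.
move=> g /= fg x Kx; rewrite distrC -(ltr_pM2r c0); apply: le_lt_trans fg.
apply: le_trans (damped_norm_ub _ x); apply: ler_wpM2l => //.
rewrite /damped_weight ler_pM ?(ltW m0) ?invr_ge0 ?addr_ge0 ?Km//.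
by rewrite lef_pV2 ?posrE ?ltr_pwDl// lerD2l; exact: Kr.
Qed.

Lemma nbhs_compact_open (K : set 'rV[R]_d) (e : R) (f : Ck kappa setT) :
  compact K -> 0 < e ->
  nbhs (Ck_fun f : {family compact, [set: 'rV[R]_d] -> R})
    [set h : {family compact, [set: 'rV[R]_d] -> R} |
      forall x : [set: 'rV[R]_d], K (set_val x) -> `|f x - h x| < e].
Proof.
move=> cK e0.
apply: (@fam_nbhs _ R compact (set_val @^-1` K) [set xy | ball xy.1 e xy.2]).
  by rewrite -entourage_ballE; exists e.
have -> : set_val @^-1` K = pt @` K.
  apply/seteqP; split=> [x rx|_ [x rx <-]//].
  by exists (set_val x) => //; exact: ptK.
apply: continuous_compact cK.
by apply: continuous_subspaceT => x; exact: pt_continuous.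
Qed.

(** Inside a ball of radius [r], two functions that are close on a large ball of
    the domain are close in the damped norm: beyond radius [rho] the damping
    factor is below [1 / rho], while the weighted difference is at most [2 r]. *)
Lemma damped_same_trace (B : set (Ck kappa setT)) (r : R) :
  B `<=` wball r -> same_trace O_ (@compact_cvg_open _ _ kappa setT) B.
Proof.
move=> Br U; split=> -[V]; last first.
  move=> [W oW <-] BUW; exists [set f | W (Ck_fun f)] => //.
  by exists [set f | W (Ck_fun f)] => //; exact: damped_compact_open.
move=> [V' oV' <-] BUV.
pose C := [set O : set {family compact, [set: 'rV[R]_d] -> R} |
  open O /\ forall f : Ck kappa setT, B f -> O (Ck_fun f) -> V' (f : D)].
pose W := \bigcup_(O in C) O.
have oW : open W by apply: bigcup_open => O [].
exists [set f | W (Ck_fun f)]; first by exists W.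
rewrite BUV; apply/seteqP; split=> f [Bf]; last first.
  by move=> [N [oN NV] Nf]; split => //; exact: NV.
move=> V'f; split => //.
move: oV'; rewrite openE => /(_ _ V'f) /nbhs_normP[e /= e0 eV'].
have [M kM] := weight_bounded kappa.
have M0 : 0 < M by rewrite (lt_le_trans (weight_gt0 kappa 0)).
have r0 : 0 <= r by rewrite (le_trans (wnorm_ge0 f))//; exact: Br.
pose rho := (r + r) / (e / 2).
have rho0 : 0 <= rho by rewrite divr_ge0 ?addr_ge0// ltW// divr_gt0.
have := @nbhs_compact_open (cball rho) (e / 2 / M) f (cball_compact (r := rho)).
rewrite !divr_gt0// => /(_ isT); set A := (X in nbhs _ X) => nA.
(* Beyond [rho], [2 r / (1 + `|x|) <= e / 2]; within, [kappa <= M]. *)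
exists (interior A); last exact: nA.
split; first exact: open_interior.
move=> g Bg /interior_subset Ag; apply: (eV' (g : D)) => /=.
rewrite (@le_lt_trans _ _ (e / 2))//; last by rewrite ltr_pdivrMr// ltr_pMr// ltr1n.
apply: damped_norm_le => x.
rewrite (_ : `|_| = `|f x - g x|)//.
have [xr|xr] := leP `|set_val x| rho.
  apply: le_trans (ler_wpM2l _ (w_le _)) _ => //.
  rewrite -(divfK (lt0r_neq0 M0) (e / 2)) ler_pM//.
    exact/ltW/weight_gt0.
  by apply/ltW/Ag.
rewrite /damped_weight mulrA ler_pdivrMr ?ltr_pwDl//.
apply: (@le_trans _ _ (r + r)).
  apply: le_trans (wnorm_ub (f - g) x) _.
  by apply: le_trans (wnormB f g) _; apply: lerD; exact: Br.
rewrite mulrC -ler_pdivrMr ?divr_gt0// (le_trans (ltW xr))//.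
by rewrite lerDr.
Qed.

Lemma compact_open_mixed (W : set {family compact, [set: 'rV[R]_d] -> R}) :
  open W -> open [set f : Ck kappa setT | W (Ck_fun f)].
Proof.
move=> oW; apply: mixed_subbase_open; exists (dampedCk kappa), to_damped; split.
- by exists id.
- by move=> B [r Br]; exact: damped_same_trace Br.
- by exists [set f | W (Ck_fun f)] => //; exact: damped_compact_open.
Qed.

(** The sets below are mixed neighbourhoods, so mixed convergence is locally
    uniform. *)
Lemma nbhs_mixed_compact (K : set 'rV[R]_d) (e : R) (f : Ck kappa setT) :
  compact K -> 0 < e -> nbhs f (compact_close K e f).
Proof.
move=> cK e0.
have := nbhs_compact_open f cK e0; set A := (X in nbhs _ X) => nA.
have := compact_open_mixed (@open_interior _ A).
rewrite openE => /(_ f nA); apply: filterS => g /interior_subset Ag x Kx.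
by rewrite distrC; exact: Ag.
Qed.

Lemma mixed_hausdorff : hausdorff_space (Ck kappa [set: 'rV[R]_d]).
Proof.
move=> f g fg; apply: CkP => x; apply/eqP/negPn/negP => fgx.
have e0 : 0 < `|f x - g x| / 2 by rewrite divr_gt0// normr_gt0 subr_eq0.
have cK : compact [set set_val x] by exact: compact_set1.
have [h [/(_ x erefl) hf /(_ x erefl) hg]] :=
  fg _ _ (nbhs_mixed_compact f cK e0) (nbhs_mixed_compact g cK e0).
have := ltrD hf hg; rewrite -splitr distrC ltNge => /negP; apply.
exact: ler_distD.
Qed.

End damped.

(** * Convergence on varying domains along sample points *)

Lemma cvg_real_unique (R : realType) (T : Type) (F : set_system T)
    {FF : ProperFilter F} (f : T -> R) (a b : R) :
  f x @[x --> F] --> a -> f x @[x --> F] --> b -> a = b.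
Proof. by move=> fa fb; apply: cvg_unique fa fb; exact: Rhausdorff. Qed.

Section systems.
Context {R : realType} {d : nat} (kappa : weight R d).

(** Approximating systems whose Lipschitz and compact-continuity constants do not
    depend on [n]. The property [sys_compact], a continuity for locally uniform
    convergence on bounded sets, is called compact continuity below. *)
Record stable_system (X : nat -> set 'rV[R]_d) (T : nat -> set R)
    (S_ : forall n, R -> Ck kappa (X n) -> Ck kappa (X n)) : Prop := {
  sys_time_approx : forall t : R, 0 <= t -> exists2 t_ : nat -> R,
    forall n, T n (t_ n) & t_ n @[n --> \oo] --> t ;
  sys_space_approx : forall x : 'rV[R]_d, exists2 x_ : nat -> 'rV[R]_d,
    forall n, X n (x_ n) & x_ n @[n --> \oo] --> x ;
  sys_time_addsub : forall n (s t : R), T n s -> T n t -> t <= s ->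
    T n (s + t) /\ T n (s - t) ;
  sys_semigroup : forall n, convex_monotone_semigroup (T n) (S_ n) ;
  sys_lipschitz : forall r T0 : R, 0 <= r -> 0 <= T0 -> exists2 c : R, 0 <= c &
    forall n t, T n t -> 0 <= t <= T0 ->
    forall f g, wball r f -> wball r g ->
      wnorm (S_ n t f - S_ n t g) <= c * wnorm (f - g) ;
  sys_compact : forall (e r T0 : R) K, 0 < e -> 0 <= r -> 0 <= T0 -> compact K ->
    exists (c : R) K', [/\ 0 <= c, compact K' &
      forall n t, T n t -> 0 <= t <= T0 ->
      forall f g, wball r f -> wball r g ->
        unorm K (S_ n t f - S_ n t g) <= c * unorm K' (f - g) + e] }.

Section samples.
Variables (X : nat -> set 'rV[R]_d) (T : nat -> set R).
Variable (S_ : forall n, R -> Ck kappa (X n) -> Ck kappa (X n)).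
Hypothesis sys : stable_system T S_.
Arguments S_ : clear implicits.

Lemma sys_T_ge0 n t : T n t -> 0 <= t.
Proof. exact: cms_time_ge0 (sys_semigroup sys n) t. Qed.

Lemma sys_T0 n : T n 0.
Proof. exact: cms_time0 (sys_semigroup sys n). Qed.

(** An index together with an admissible time and an admissible point. Since
    times and points range over sets that vary with [n], a limit over all of them
    at once is a limit over samples. *)
Record sample := Sample { ix : nat ; tm : R ; sp : X ix ; tmP : T ix tm }.

Definition samples_at (t : R) (x : 'rV[R]_d) : set_system sample :=
  [set A | exists2 delta : R, 0 < delta & exists N, forall p,
    (N <= ix p)%N -> `|tm p - t| < delta -> `|set_val (sp p) - x| < delta -> A p].

Lemma samples_at_filter t x : Filter (samples_at t x).
Proof.
split.
- by exists 1 => //; exists 0%N.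
- move=> A B [d1 d1_gt0 [N1 A1]] [d2 d2_gt0 [N2 B2]].
  exists (Num.min d1 d2); first by rewrite lt_min d1_gt0.
  exists (maxn N1 N2) => p; rewrite geq_max !lt_min.
  by move=> /andP[? ?] /andP[? ?] /andP[? ?]; split; [exact: A1|exact: B2].
- move=> A B AB [d1 d1_gt0 [N1 A1]]; exists d1 => //; exists N1 => p ? ? ?.
  exact/AB/A1.
Qed.

(** Density of the admissible times and points in the limit. *)
Lemma samples_at_proper t x : 0 <= t -> ProperFilter (samples_at t x).
Proof.
move=> t0; apply: Build_ProperFilter_ex; last exact: samples_at_filter.
move=> A [e e0 [N AN]].
have [t_ Tt t_t] := sys_time_approx sys t0.
have [x_ Xx x_x] := sys_space_approx sys x.
have [n [[/= Nn tn] xn]] : exists n, ((N <= n)%N /\ `|t_ n - t| < e) /\ `|x_ n - x| < e.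
  apply: (@filter_ex _ \oo); apply: filterI; first apply: filterI.
  - exact: nbhs_infty_ge.
  - by move/cvgr_distC_lt : t_t; exact.
  - by move/cvgr_distC_lt : x_x; exact.
by exists (Sample (SigSub (mem_set (Xx n))) (Tt n)); apply: AN.
Qed.

Local Existing Instance samples_at_filter.

Implicit Types (t : R) (x : 'rV[R]_d).

Lemma samples_ix t x : ix p @[p --> samples_at t x] --> \oo.
Proof. by move=> A [N _ NA]; exists 1 => //; exists N => p Np _ _; exact: NA. Qed.

Lemma samples_along (u : nat -> R) (l t : R) x :
  u n @[n --> \oo] --> l -> u (ix p) @[p --> samples_at t x] --> l.
Proof. by move=> ul; apply: cvg_comp ul; exact: samples_ix. Qed.

Lemma samples_tm t x : tm p @[p --> samples_at t x] --> t.
Proof.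
by apply/cvgrPdistC_lt => e e0; exists e => //; exists 0%N.
Qed.

Lemma samples_sp t x : set_val (sp p) @[p --> samples_at t x] --> x.
Proof.
by apply/cvgrPdistC_lt => e e0; exists e => //; exists 0%N.
Qed.

Lemma samples_tm_le t x : 0 <= t ->
  \forall p \near samples_at t x, 0 <= tm p <= t + 1.
Proof.
move=> t0; exists 1 => //; exists 0%N => p _ tp _; rewrite (sys_T_ge0 (tmP p)) /=.
by move: tp; rewrite ltr_norml => /andP[_]; rewrite ltrBlDl => /ltW.
Qed.

Lemma samples_cball t x :
  \forall p \near samples_at t x, cball (`|x| + 1) (set_val (sp p)).
Proof.
exists 1 => //; exists 0%N => p _ _ xp; rewrite /cball /=.
by rewrite -lerBlDl (le_trans (lerB_dist _ _))// ltW.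
Qed.

Lemma samples_Ck f t x :
  restr (X (ix p)) f (sp p) @[p --> samples_at t x] --> (f : Ck kappa setT) (pt x).
Proof.
apply: (cvg_comp (fun p : sample => set_val (sp p)) (fun y => f (pt y))).
  exact: samples_sp.
exact: Ck_continuous.
Qed.

Lemma samples_unorm (f_ : forall n, Ck kappa (X n)) t x :
  (forall K, compact K -> unorm K (f_ n) @[n --> \oo] --> (0 : R)) ->
  f_ (ix p) (sp p) @[p --> samples_at t x] --> (0 : R).
Proof.
move=> f0; have cK : compact (cball (`|x| + 1) : set 'rV[R]_d) by exact: cball_compact.
apply/norm_cvg0P.
apply: (squeeze_cvgr _ (cvg_cst 0) (samples_along t x (f0 _ cK))).
near=> p; rewrite normr_ge0 /= unorm_ub//.
by near: p; exact: samples_cball.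
Unshelve. all: by end_near. Qed.

Lemma Ck_cvg_unorm (f_ : forall n, Ck kappa (X n)) (f : Ck kappa setT) K :
  Ck_cvg f_ f -> compact K -> unorm K (restr (X n) f - f_ n) @[n --> \oo] --> (0 : R).
Proof.
move=> ff cK; apply: Ck_cvg_compact ff cK.
by have [x_ Xx x_0] := sys_space_approx sys 0; exists x_ => //; apply/cvg_ex; exists 0.
Qed.

(** Convergence in the sense of [Ck_cvg] is continuous convergence: points that
    vary with [n] are allowed. *)
Lemma samples_cvg (f_ : forall n, Ck kappa (X n)) (f : Ck kappa setT) t x : Ck_cvg f_ f ->
  f_ (ix p) (sp p) @[p --> samples_at t x] --> f (pt x).
Proof.
move=> ff.
rewrite -[f _]subr0 (_ : (fun p => _) = (fun p => restr (X (ix p)) f (sp p)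
   - (restr (X (ix p)) f - f_ (ix p)) (sp p))).
  apply: cvgB; first exact: samples_Ck.
  apply: (@samples_unorm (fun n => restr (X n) f - f_ n)) => K cK.
  exact: Ck_cvg_unorm.
by apply/funext => p; rewrite !CkE opprB addrC subrK.
Qed.

(** Conversely, convergence along the samples is uniform on compact sets, by
    covering the compact set with the neighbourhoods in which the limit is
    nearly reached. *)
Lemma Ck_cvg_samples (phi : forall n, R -> Ck kappa (X n)) (t_ : nat -> R) t
    (f : Ck kappa setT) :
  0 <= t -> (forall n, T n (t_ n)) -> t_ n @[n --> \oo] --> t ->
  (exists C, forall n, wnorm (phi n (t_ n)) <= C) ->
  (forall x, phi (ix p) (tm p) (sp p) @[p --> samples_at t x] --> f (pt x)) ->
  Ck_cvg (fun n => phi n (t_ n)) f.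
Proof.
move=> t0 Tt t_t bphi phif; split => // K cK _.
apply/cvgr0Pnorm_le => e e0.
pose close n x := forall y : X n, set_val y = x ->
  `|f (pt x) - phi n (t_ n) y| <= e.
have e2 : 0 < e / 2 by rewrite divr_gt0.
have cover x0 : K x0 -> \forall x \near x0 & n \near \oo, close n x.
  move=> _.
  have [D D0 [N DN]] : \forall p \near samples_at t x0,
      `|f (pt x0) - phi (ix p) (tm p) (sp p)| < e / 2.
    by move/cvgrPdist_lt : (phif x0); exact.
  near=> x n.
  have fx : `|f (pt x) - f (pt x0)| < e / 2.
    by near: x; move/cvgr_distC_lt : (@Ck_continuous _ _ _ f x0); exact.
  have xD : `|x - x0| < D.
    by near: x; move/cvgr_distC_lt : (@cvg_id _ (nbhs x0)); exact.
  have Nn : (N <= n)%N by near: n; exact: nbhs_infty_ge.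
  have tD : `|t_ n - t| < D by near: n; move/cvgr_distC_lt : t_t; exact.
  move=> y yx.
  rewrite (le_trans (ler_distD (f (pt x0)) _ _))// [e]splitr lerD//.
    exact: ltW.
  by apply/ltW/(DN (Sample y (Tt n))) => //=; rewrite yx.
have Kclose := (compact_near_coveringP K).1 cK nat \oo close _ cover.
near=> n; have Kn : K `<=` close n by near: n; exact: Kclose.
rewrite ger0_norm; last exact: unorm_ge0.
by apply: unorm_le => [|y Ky]; [exact: ltW|exact: Kn].
Unshelve. all: by end_near. Qed.

Lemma Ck_cvg_unique (f_ : forall n, Ck kappa (X n)) (f g : Ck kappa setT) :
  Ck_cvg f_ f -> Ck_cvg f_ g -> f = g.
Proof.
move=> ff fg; apply: CkP => x; rewrite -(ptK x).
have PF := samples_at_proper (set_val x) (lexx (0 : R)).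
exact: (cvg_real_unique (samples_cvg 0 ff) (samples_cvg 0 fg)).
Qed.

(** Sample limits are jointly continuous, since nearby points share their
    samples. *)
Lemma samples_lim_continuous (F : sample -> R) (u : R -> 'rV[R]_d -> R) :
  (forall t x, 0 <= t -> F p @[p --> samples_at t x] --> u t x) ->
  forall t x (e : R), 0 <= t -> 0 < e ->
  exists2 delta : R, 0 < delta & forall s y, 0 <= s ->
    `|s - t| < delta -> `|y - x| < delta -> `|u s y - u t x| <= e.
Proof.
move=> Fu t x e t0 e0.
have /cvgrPdist_le /(_ _ e0) [D D0 [N DN]] := Fu t x t0.
exists D => // s y s0 sD yD; have PF := samples_at_proper y s0.
rewrite distrC.
apply: (cvgr_to_le (F := samples_at s y) (cvg_norm (cvgB (cvg_cst (u t x)) (Fu s y s0)))).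
exists (Num.min (D - `|s - t|) (D - `|y - x|)).
  by rewrite lt_min !subr_gt0 sD yD.
exists N => p Np; rewrite !lt_min !ltrBrDr => /andP[sp _] /andP[_ yp].
apply: DN => //.
  by rewrite (le_lt_trans (ler_distD s _ _)).
by rewrite (le_lt_trans (ler_distD y _ _)).
Qed.

(** The constant sequence [0] decreases to [0], so its image does as well. *)
Lemma sys_zero n t : T n t -> S_ n t 0 = 0.
Proof.
move=> Tt; apply: CkP => x.
have : decreases_to (fun=> 0 : Ck kappa (X n)) 0.
  by move=> y; split; [move=> ? ?|exact: cvg_cst].
move=> /(cms_decr (sys_semigroup sys n) Tt) /(_ x)[_].
move=> S0; apply: (@cvg_real_unique _ _ \oo _ (fun=> S_ n t 0 x)) => //.
exact: cvg_cst.
Qed.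

Lemma sys_bounded r T0 : 0 <= r -> 0 <= T0 -> exists2 C, 0 <= C &
  forall n t f, T n t -> t <= T0 -> wball r f -> wnorm (S_ n t f) <= C.
Proof.
move=> r0 T00; have [c c0 cP] := sys_lipschitz sys r0 T00.
exists (c * r); first exact: mulr_ge0.
move=> n t f Tt tT fr; have := cP n t Tt _ f 0 fr.
rewrite (sys_T_ge0 Tt) tT sys_zero// !subr0 => /(_ isT) H.
apply: le_trans (H _) _; last by rewrite ler_wpM2l.
apply: wnorm_le => // x.
by rewrite Ck0E normr0 mul0r.
Qed.

Lemma samples_compact (r t e : R) x : 0 <= r -> 0 <= t -> 0 < e ->
  exists (c : R) K', [/\ 0 <= c, compact K' &
    \forall p \near samples_at t x, forall f g, wball r f -> wball r g ->
      `|S_ (ix p) (tm p) f (sp p) - S_ (ix p) (tm p) g (sp p)|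
        <= c * unorm K' (f - g) + e].
Proof.
move=> r0 t0 e0; have cK : compact (cball (`|x| + 1) : set 'rV[R]_d) by exact: cball_compact.
have t10 : 0 <= t + 1 by rewrite addr_ge0.
have [c [K' [c0 cK' cP]]] := sys_compact sys e0 r0 t10 cK.
exists c, K'; split => //; near=> p => f g fr gr.
apply: le_trans (cP _ _ (tmP p) _ _ _ fr gr).
  by rewrite -CkBE unorm_ub//; near: p; exact: samples_cball.
by near: p; exact: samples_tm_le.
Unshelve. all: by end_near. Qed.

(** Initial values that agree asymptotically on compact sets have images that
    agree asymptotically. *)
Lemma samples_diff (f_ g_ : forall n, Ck kappa (X n)) (r t : R) x :
  (forall n, wball r (f_ n)) -> (forall n, wball r (g_ n)) -> 0 <= t ->
  (forall K, compact K -> unorm K (f_ n - g_ n) @[n --> \oo] --> (0 : R)) ->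
  S_ (ix p) (tm p) (f_ (ix p)) (sp p) - S_ (ix p) (tm p) (g_ (ix p)) (sp p)
    @[p --> samples_at t x] --> (0 : R).
Proof.
move=> fr gr t0 fg; apply/cvgr0Pnorm_le => e e0.
have r0 : 0 <= r by exact: le_trans (wnorm_ge0 (f_ 0%N)) (fr 0%N).
have e2 : 0 < e / 2 by rewrite divr_gt0.
have [c [K [c0 cK cP]]] := samples_compact x r0 t0 e2.
have cu : c * unorm K (f_ (ix p) - g_ (ix p)) @[p --> samples_at t x] --> (0 : R).
  by rewrite -(mulr0 c); apply: cvgM (cvg_cst _) (samples_along t x (fg K cK)).
move/cvgr0Pnorm_le : cu => /(_ _ e2) cu_le.
near=> p.
apply: le_trans (near cP p _ _ _ (fr _) (gr _)) _ => //.
rewrite [leRHS]splitr lerD2r (le_trans (ler_norm _))//.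
by near: p; exact: cu_le.
Unshelve. all: by end_near. Qed.

Lemma bounded_restr_cvg (f_ : forall n, Ck kappa (X n)) (f : Ck kappa setT) : Ck_cvg f_ f ->
  exists r, (forall n, wball r (f_ n)) /\ (forall n, wball r (restr (X n) f)).
Proof.
move=> [[C fC] _]; exists (Num.max C (wnorm f)); split=> n.
  by rewrite /wball /= le_max fC.
by rewrite /wball /= le_max wnorm_restr orbT.
Qed.

End samples.
End systems.

(** * The limit semigroup *)

Section limit_semigroup.
Context {R : realType} {d : nat} {kappa : weight R d}.
Variables (X : nat -> set 'rV[R]_d) (T : nat -> set R).
Variable (S_ : forall n, R -> Ck kappa (X n) -> Ck kappa (X n)).
Arguments S_ : clear implicits.
Hypothesis sys : stable_system T S_.
Local Notation near_at := (@samples_at _ _ X T).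

Local Existing Instance samples_at_filter.
Implicit Types (t r e : R) (x : 'rV[R]_d).

(** Weighted bounds pass to the limit along samples, because the weight is
    continuous at the limit point. *)
Lemma samples_weighted_le (F : sample X T -> R) (C : sample X T -> R) (l c t : R) x :
  0 <= t -> F p @[p --> near_at t x] --> l -> C p @[p --> near_at t x] --> c ->
  (\forall p \near near_at t x, `|F p| * kappa (set_val (sp p)) <= C p) ->
  `|l| * kappa x <= c.
Proof.
move=> t0 Fl Cc FC; have PF := samples_at_proper sys x t0.
rewrite -subr_ge0; apply: (cvgr_to_ge (F := near_at t x)
  (f := fun p => C p - `|F p| * kappa (set_val (sp p)))).
  apply: cvgB => //; apply: cvgM; first exact: cvg_norm.
  apply: (cvg_comp (fun p : sample X T => set_val (sp p)) kappa); first exact: samples_sp.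
  exact: weight_continuous.
by apply: filterS FC => p; rewrite subr_ge0.
Qed.

Section rates.
Variables (f_ : forall n, Ck kappa (X n)) (t_ : nat -> R).
Hypothesis f_rate : bounded_rate T S_ f_ t_.
Variable r : R.
Hypothesis f_r : forall n, wball r (f_ n).

Let r_ge0 : 0 <= r.
Proof. exact: le_trans (wnorm_ge0 _) (f_r 0%N). Qed.

(** The rate is only controlled on [(0, t_ n]], where [t_ n] may vanish in the
    limit; the semigroup law and the uniform Lipschitz bound carry it over to
    bounded times, one step of length [t_ n] after the other. *)
Lemma rate_extends T0 : 0 <= T0 -> exists2 L : R, 0 <= L &
  forall n s, T n s -> s <= T0 -> wnorm (S_ n s (f_ n) - f_ n) <= L * s.
Proof.
move=> T00; have [Tt [M tM] [C fC]] := f_rate.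
have C0 : 0 <= C.
  have [Tt0 t00] := Tt 0%N.
  apply: le_trans (fC 0%N _ Tt0 _); first exact: wnorm_ge0.
  by rewrite lexx andbT lt_neqAle eq_sym t00 (sys_T_ge0 sys Tt0).
have [B B0 SB] := sys_bounded sys r_ge0 T00.
have rB0 : 0 <= r + B by rewrite addr_ge0.
have [c c0 cP] := sys_lipschitz sys rB0 T00.
have first_step n s : T n s -> s <= t_ n -> wnorm (S_ n s (f_ n) - f_ n) <= C * s.
  move=> Ts st; have [->|s_gt0] := eqVneq s 0.
    rewrite (cms_0 (sys_semigroup sys n)) subrr mulr0; apply: wnorm_le => // x.
    by rewrite Ck0E normr0 mul0r.
  have s0 : 0 < s by rewrite lt_neqAle eq_sym s_gt0 (sys_T_ge0 sys Ts).
  have := fC n s Ts; rewrite s0 st => /(_ isT) /(ler_wpM2l (ltW s0)).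
  rewrite mulrC [in leRHS]mulrC; apply: le_trans.
  rewrite /diff_quot mulrC; apply: wnorm_le => [|x].
    by rewrite mulr_ge0 ?wnorm_ge0// ltW.
  have := wnorm_ub (s^-1 *: (S_ n s (f_ n) - f_ n)) x.
  by rewrite CkE normrM gtr0_norm ?invr_gt0// -mulrA ler_pdivrMl.
exists (C + c * C); first by rewrite addr_ge0// mulr_ge0.
move=> n s Ts sT; have [Tn tn0] := Tt n.
have t0 : 0 < t_ n by rewrite lt_neqAle eq_sym tn0 (sys_T_ge0 sys Tn).
have [k sk] : exists k : nat, s <= t_ n *+ k.
  exists (Num.truncn (s / t_ n)).+1; rewrite -mulr_natr mulrC -ler_pdivrMr//.
  by apply/ltW; exact: truncnS_gt.
elim: k s Ts sT sk => [|k IH] s Ts sT sk.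
  have -> : s = 0 by apply/eqP; rewrite eq_le sk (sys_T_ge0 sys Ts).
  apply: le_trans (first_step n 0 (sys_T0 sys n) (ltW t0)) _; rewrite !mulr0//.
have [st|ts] := leP s (t_ n).
  apply: le_trans (first_step n s Ts st) _; rewrite ler_wpM2r ?(sys_T_ge0 sys Ts)//.
  by rewrite lerDl mulr_ge0.
have [_ Tst] := sys_time_addsub sys Ts Tn (ltW ts).
have stT : s - t_ n <= T0 by rewrite lerBlDr (le_trans sT)// lerDl ltW.
have := IH _ Tst stT; rewrite lerBlDr -mulrSr sk => /(_ isT) IHs.
have E : S_ n s (f_ n) = S_ n (s - t_ n) (S_ n (t_ n) (f_ n)).
  by rewrite -(cms_D (sys_semigroup sys n) Tst Tn) subrK.
rewrite E -[_ - f_ n](subrKA (S_ n (s - t_ n) (f_ n))).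
apply: le_trans (wnormD _ _) _.
have -> : (C + c * C) * s = (C + c * C) * t_ n + (C + c * C) * (s - t_ n).
  by rewrite -mulrDr [t_ n + _]addrC subrK.
apply: lerD => //.
apply: le_trans (cP n _ Tst _ _ _ _ _) _.
- by rewrite stT (sys_T_ge0 sys Tst).
- rewrite /wball /= (le_trans (SB n _ _ Tn _ (f_r n)))// ?lerDr//.
  exact: le_trans (ltW ts) sT.
- by rewrite /wball /= (le_trans (f_r n))// lerDl.
apply: le_trans (ler_wpM2l c0 (first_step n _ Tn (lexx _))) _.
by rewrite mulrA ler_wpM2r ?(ltW t0)// lerDr.
Qed.

(** By the semigroup law, two times differ by a step from time [0], and the
    semigroup transports this step with a uniform Lipschitz constant. *)
Lemma rate_lipschitz T0 : 0 <= T0 -> exists2 L : R, 0 <= L &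
  forall n s t, T n s -> T n t -> s <= T0 -> t <= T0 ->
    wnorm (S_ n s (f_ n) - S_ n t (f_ n)) <= L * `|s - t|.
Proof.
move=> T00; have [L L0 LP] := rate_extends T00.
have [B B0 SB] := sys_bounded sys r_ge0 T00.
have rB0 : 0 <= r + B by rewrite addr_ge0.
have [c c0 cP] := sys_lipschitz sys rB0 T00.
have H n s t : T n s -> T n t -> s <= T0 -> t <= s ->
    wnorm (S_ n s (f_ n) - S_ n t (f_ n)) <= c * L * `|s - t|.
  move=> Ts Tt sT ts; have [_ Tst] := sys_time_addsub sys Ts Tt ts.
  have stT : s - t <= T0 by rewrite lerBlDr (le_trans sT)// lerDl (sys_T_ge0 sys Tt).
  have -> : S_ n s (f_ n) = S_ n t (S_ n (s - t) (f_ n)).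
    by rewrite -(cms_D (sys_semigroup sys n) Tt Tst) addrC subrK.
  apply: le_trans (cP n _ Tt _ _ _ _ _) _.
  - by rewrite (sys_T_ge0 sys Tt) (le_trans ts).
  - by rewrite /wball /= (le_trans (SB n _ _ Tst stT (f_r n)))// lerDr.
  - by rewrite /wball /= (le_trans (f_r n))// lerDl.
  rewrite -mulrA ler_wpM2l// ger0_norm ?subr_ge0//; exact: LP.
exists (c * L); first exact: mulr_ge0.
move=> n s t Ts Tt sT tT; have [ts|st] := leP t s; first exact: H.
by rewrite -wnormN opprB distrC; apply: H => //; exact: ltW.
Qed.

End rates.

Variable S : R -> Ck kappa setT -> Ck kappa setT.
Hypothesis S_lim : forall (f : Ck kappa setT) t x, 0 <= t ->
  S_ (ix p) (tm p) (restr (X (ix p)) f) (sp p) @[p --> near_at t x]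
    --> S t f (pt x).

Implicit Types (f g : Ck kappa setT).

(** Compact continuity lets arbitrary approximations [f_] of [f] replace the
    restrictions of [f] by which the limit is defined. *)
Lemma limit_samples (f_ : forall n, Ck kappa (X n)) f t x : 0 <= t -> Ck_cvg f_ f ->
  S_ (ix p) (tm p) (f_ (ix p)) (sp p) @[p --> near_at t x] --> S t f (pt x).
Proof.
move=> t0 ff; have [r [fr rr]] := bounded_restr_cvg ff.
have diff : S_ (ix p) (tm p) (f_ (ix p)) (sp p)
    - S_ (ix p) (tm p) (restr (X (ix p)) f) (sp p) @[p --> near_at t x] --> (0 : R).
  apply: (samples_diff (g_ := fun n => restr (X n) f) sys x fr rr t0) => K cK.
  under eq_fun do rewrite -unormN opprB.
  exact: (Ck_cvg_unorm sys ff cK).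
rewrite -[S t f _]add0r (_ : (fun p => _) = (fun p =>
    (S_ (ix p) (tm p) (f_ (ix p)) (sp p)
     - S_ (ix p) (tm p) (restr (X (ix p)) f) (sp p))
    + S_ (ix p) (tm p) (restr (X (ix p)) f) (sp p))).
  exact: (cvgD diff (@S_lim f t x t0)).
by apply/funext => p /=; rewrite subrK.
Qed.

Lemma limit_Ck_cvg (f_ : forall n, Ck kappa (X n)) f t (t_ : nat -> R) :
  0 <= t -> (forall n, T n (t_ n)) ->
  t_ n @[n --> \oo] --> t -> Ck_cvg f_ f ->
  Ck_cvg (fun n => S_ n (t_ n) (f_ n)) (S t f).
Proof.
move=> t0 Tt t_t ff.
apply: (Ck_cvg_samples (phi := fun n s => S_ n s (f_ n)) t0 Tt t_t); last first.
  by move=> x; exact: limit_samples.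
have [r [fr _]] := bounded_restr_cvg ff.
have r0 : 0 <= r by exact: le_trans (wnorm_ge0 (f_ 0%N)) (fr 0%N).
have /cvg_seq_bounded[M [_ tM]] : cvg (t_ n @[n --> \oo]) by apply/cvg_ex; exists t.
have M0 : 0 <= `|M| + 1 by rewrite addr_ge0.
have [C _ SC] := sys_bounded sys r0 M0.
exists C => n; apply: SC => //; apply: le_trans (ler_norm _) _.
by apply: (tM (`|M| + 1)) => //; rewrite (le_lt_trans (ler_norm M))// ltrDl.
Qed.

Lemma Ck_cvg_restr f : Ck_cvg (fun n => restr (X n) f) f.
Proof.
split; first by exists (wnorm f) => n; exact: wnorm_restr.
move=> K cK _; rewrite (_ : (fun n => _) = fun=> 0); first exact: cvg_cst.
apply/funext => n; apply/eqP; rewrite eq_le unorm_ge0// andbT.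
by apply: unorm_le => // x _; rewrite subrr Ck0E normr0.
Qed.

Lemma limit_lipschitz r T0 : 0 <= r -> 0 <= T0 -> exists2 c : R, 0 <= c &
  forall t, 0 <= t <= T0 -> forall f g, wball r f -> wball r g ->
    wnorm (S t f - S t g) <= c * wnorm (f - g).
Proof.
move=> r0 T00; have T10 : 0 <= T0 + 1 by rewrite addr_ge0.
have [c c0 cP] := sys_lipschitz sys r0 T10; exists c => //.
move=> t /andP[t0 tT] f g fr gr.
apply: wnorm_le => [|x]; first by rewrite mulr_ge0 ?wnorm_ge0.
rewrite -(ptK x); set y := set_val x.
apply: (samples_weighted_le t0 (cvgB (@S_lim f t y t0) (@S_lim g t y t0)) (cvg_cst _)).
have H := samples_tm_le sys y t0; apply: filterS H => p /andP[p0 pt1].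
apply: le_trans (wnorm_ub (_ - _) (sp p)) _.
apply: le_trans (cP _ _ (tmP p) _ _ _ _ _) _.
- by rewrite p0 (le_trans pt1)// lerD2r.
- exact: le_trans (wnorm_restr _ _) fr.
- exact: le_trans (wnorm_restr _ _) gr.
by rewrite ler_wpM2l// -restrB wnorm_restr.
Qed.

Lemma limit_bounded r T0 : 0 <= r -> 0 <= T0 -> exists2 C : R, 0 <= C &
  forall t f, 0 <= t <= T0 -> wball r f -> wnorm (S t f) <= C.
Proof.
move=> r0 T00; have T10 : 0 <= T0 + 1 by rewrite addr_ge0.
have [C C0 SC] := sys_bounded sys r0 T10; exists C => //.
move=> t f /andP[t0 tT] fr; apply: wnorm_le => // x.
rewrite -(ptK x); set y := set_val x.
apply: (samples_weighted_le t0 (@S_lim f t y t0) (cvg_cst _)).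
have H := samples_tm_le sys y t0; apply: filterS H => p /andP[p0 pt1].
apply: le_trans (wnorm_ub _ (sp p)) _; apply: SC; first exact: tmP.
  by rewrite (le_trans pt1)// lerD2r.
exact: le_trans (wnorm_restr _ _) fr.
Qed.

(** A point of [K] is only a limit of points of [X n], which may lie outside
    [K]; hence the detour through a ball that contains a neighbourhood of [K]. *)
Lemma limit_compact e r T0 K : 0 < e -> 0 <= r -> 0 <= T0 -> compact K ->
  exists (c : R) K', [/\ 0 <= c, compact K' &
    forall t, 0 <= t <= T0 -> forall f g, wball r f -> wball r g ->
      unorm K (S t f - S t g) <= c * unorm K' (f - g) + e].
Proof.
move=> e0 r0 T00 cK; have T10 : 0 <= T0 + 1 by rewrite addr_ge0.
have [q q0 Kq] := compact_cball cK.
have cK1 : compact (cball (q + 1) : set 'rV[R]_d) by exact: cball_compact.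
have [c [K' [c0 cK' cP]]] := sys_compact sys e0 r0 T10 cK1.
exists c, K'; split => // t /andP[t0 tT] f g fr gr.
apply: unorm_le => [|x Kx].
  by apply: addr_ge0 (ltW e0); rewrite mulr_ge0// unorm_ge0.
rewrite -(ptK x); set y := set_val x.
have PF := samples_at_proper sys y t0.
apply: (cvgr_to_le (F := near_at t y) (cvg_norm (cvgB (@S_lim f t y t0) (@S_lim g t y t0)))).
have H1 := samples_tm_le sys y t0; have H2 := @samples_cball _ _ X T t y.
near=> p.
have /andP[p0 pt1] : 0 <= tm p <= t + 1 by near: p; exact: H1.
have py : cball (`|y| + 1) (set_val (sp p)) by near: p; exact: H2.
apply: le_trans (unorm_ub (_ - _) (x := sp p) cK1 _) _.
  by apply: le_trans py _; rewrite lerD2r; exact: Kq.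
apply: le_trans (cP _ _ (tmP p) _ _ _ _ _) _.
- by rewrite p0 (le_trans pt1)// lerD2r.
- exact: le_trans (wnorm_restr _ _) fr.
- exact: le_trans (wnorm_restr _ _) gr.
by rewrite lerD2r ler_wpM2l// -restrB unorm_restr.
Unshelve. all: by end_near. Qed.


Lemma limit_zero t : 0 <= t -> S t 0 = 0.
Proof.
move=> t0; apply: CkP => x; rewrite -(ptK x); set y := set_val x.
have PF := samples_at_proper sys y t0.
apply: (cvg_real_unique (@S_lim 0 t y t0)).
rewrite (_ : (fun p => _) = fun=> 0); first exact: cvg_cst.
apply/funext => p; rewrite (_ : restr _ 0 = 0); last exact: CkP.
by rewrite (sys_zero sys (tmP p)).
Qed.

Lemma limit_convex t : 0 <= t -> convex_op (S t).
Proof.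
move=> t0 a f g a01 x; rewrite -(ptK x); set y := set_val x.
have PF := samples_at_proper sys y t0.
rewrite -subr_ge0; apply: (cvgr_to_ge (F := near_at t y) (cvgB
  (cvgD (cvgM (cvg_cst a) (@S_lim f t y t0)) (cvgM (cvg_cst (1 - a)) (@S_lim g t y t0)))
  (@S_lim (a *: f + (1 - a) *: g) t y t0))).
apply: nearW => p; rewrite subr_ge0.
rewrite (_ : restr _ (a *: f + _) = a *: restr _ f + (1 - a) *: restr _ g).
  exact: (cms_convex (sys_semigroup sys _) (tmP p)).
exact: CkP.
Qed.

Lemma limit_monotone t : 0 <= t -> monotone_op (S t).
Proof.
move=> t0 f g fg x; rewrite -(ptK x); set y := set_val x.
have PF := samples_at_proper sys y t0.
rewrite -subr_ge0; apply: (cvgr_to_ge (F := near_at t y)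
  (cvgB (@S_lim g t y t0) (@S_lim f t y t0))).
apply: nearW => p; rewrite subr_ge0.
by apply: (cms_monotone (sys_semigroup sys _) (tmP p)) => z; exact: fg.
Qed.

Lemma decreasing_ge0 (f_ : nat -> Ck kappa setT) :
  decreases_to f_ 0 -> forall n (x : [set: 'rV[R]_d]), 0 <= f_ n x.
Proof.
move=> fdecr n x; have [fx f0] := fdecr x.
have cf : cvg (f_ n x @[n --> \oo]) by apply/cvg_ex; exists 0.
by have := nonincreasing_cvgn_ge fx cf n; rewrite (cvg_lim (@Rhausdorff R) f0).
Qed.

(** Dini's theorem, by compactness of [K]: near each point some [f_ m] is small,
    and so are all later functions. *)
Lemma dini (f_ : nat -> Ck kappa setT) (K : set 'rV[R]_d) e :
  decreases_to f_ 0 -> compact K -> 0 < e ->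
  \forall n \near \oo, unorm K (f_ n) <= e.
Proof.
move=> fdecr cK e0.
have cover x0 : K x0 -> \forall x \near x0 & n \near \oo, f_ n (pt x) < e.
  move=> _; have [_ f0] := fdecr (pt x0).
  have [m fm] : exists m, f_ m (pt x0) < e.
    apply: (@filter_ex _ \oo _ [set m | f_ m (pt x0) < e]).
    exact: (cvgr_lt _ f0).
  near=> x n.
  have mn : (m <= n)%N by near: n; exact: nbhs_infty_ge.
  apply: (@le_lt_trans _ _ (f_ m (pt x))); first exact: (fdecr (pt x)).1.
  by near: x; exact: (cvgr_lt _ (@Ck_continuous _ _ _ (f_ m) x0)).
have Kclose := (compact_near_coveringP K).1 cK nat \oo (fun n x => f_ n (pt x) < e) _ cover.
near=> n; have Kn : K `<=` (fun x => f_ n (pt x) < e) by near: n; exact: Kclose.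
apply: unorm_le => [|x Kx]; first exact: ltW.
rewrite ger0_norm; last exact: decreasing_ge0.
by rewrite -(ptK x); exact/ltW/Kn.
Unshelve. all: by end_near. Qed.

(** Dini's theorem makes the decrease locally uniform, and compact continuity
    of the limit carries this over to the images. *)
Lemma limit_decr t (f_ : nat -> Ck kappa setT) : 0 <= t ->
  decreases_to f_ 0 -> decreases_to (fun n => S t (f_ n)) 0.
Proof.
move=> t0 fdecr x; split.
  by move=> m n mn; apply: limit_monotone => // y; exact: (fdecr y).1.
have r0 := wnorm_ge0 (f_ 0%N).
have fr n : wball (wnorm (f_ 0%N)) (f_ n).
  apply: wnorm_le => // y; apply: le_trans (wnorm_ub _ y).
  rewrite ler_wpM2r ?(ltW (weight_gt0 _ _))// !ger0_norm ?decreasing_ge0//.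
  exact: (fdecr y).1.
have zr : wball (wnorm (f_ 0%N)) (0 : Ck kappa setT).
  by apply: wnorm_le => // y; rewrite Ck0E normr0 mul0r.
apply/cvgr0Pnorm_le => e e0; have e2 : 0 < e / 2 by rewrite divr_gt0.
have cx : compact [set set_val x] by exact: compact_set1.
have [c [K [c0 cK cP]]] := limit_compact e2 r0 t0 cx.
have c1 : 0 < e / 2 / (c + 1) by rewrite divr_gt0// ltr_wpDl.
have fK := dini fdecr cK c1.
near=> n; have fKn : unorm K (f_ n) <= e / 2 / (c + 1) by near: n; exact: fK.
have t01 : 0 <= t <= t by rewrite t0 lexx.
have := cP t t01 _ _ (fr n) zr; rewrite limit_zero// !subr0 => H.
apply: le_trans (unorm_ub (S t (f_ n)) (x := x) cx erefl) _.
apply: le_trans H _; rewrite [leRHS]splitr lerD2r.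
rewrite ler_pdivlMr ?ltr_wpDl// in fKn.
apply: le_trans fKn; rewrite mulrC ler_wpM2l ?unorm_ge0//.
by rewrite lerDl.
Unshelve. all: by end_near. Qed.

Lemma limit_cms : convex_monotone_semigroup [set t : R | 0 <= t] S.
Proof.
split=> //=.
- by move=> s t; exact: addr_ge0.
- by move=> t; exact: limit_convex.
- by move=> t; exact: limit_monotone.
- by move=> t t0 f_; exact: limit_decr.
- move=> f; apply: (Ck_cvg_unique sys (f_ := fun n => restr (X n) f)); last first.
    exact: Ck_cvg_restr.
  rewrite (_ : (fun n => _) = fun n => S_ n 0 (restr (X n) f)).
    apply: limit_Ck_cvg (sys_T0 sys) _ (Ck_cvg_restr f); [exact: lexx|exact: cvg_cst].
  by apply: functional_extensionality_dep => n; rewrite (cms_0 (sys_semigroup sys n)).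
- move=> s t s0 t0 f.
  have [s_ Ts s_s] := sys_time_approx sys s0.
  have [t_ Tt t_t] := sys_time_approx sys t0.
  apply: (Ck_cvg_unique sys).
    apply: (limit_Ck_cvg _ _ (cvgD s_s t_t) (Ck_cvg_restr f)).
      exact: addr_ge0.
    by move=> n; exact: (cms_timeD (sys_semigroup sys n)).
  rewrite (_ : (fun n => _) = fun n => S_ n (s_ n) (S_ n (t_ n) (restr (X n) f))).
    by do 2 apply: limit_Ck_cvg => //; exact: Ck_cvg_restr.
  by apply: functional_extensionality_dep => n; rewrite (cms_D (sys_semigroup sys n)).
- move=> r T0 r0 T00.
  have [C _ SC] := limit_bounded (wnorm_ge0 (divr_weight kappa setT r)) T00.
  by exists C => t t0 /= tT; apply: SC => //; exact: lexx.
Qed.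

Lemma limit_continuous f t x e : 0 <= t -> 0 < e ->
  exists2 delta : R, 0 < delta & forall s y, 0 <= s ->
    `|s - t| < delta -> `|y - x| < delta -> `|S s f (pt y) - S t f (pt x)| <= e.
Proof.
move=> t0 e0.
exact: (samples_lim_continuous (u := fun s y => S s f (pt y)) sys (@S_lim f) x t0 e0).
Qed.

(** Joint continuity at time [0] gives locally uniform convergence, and the
    functions [S t f] stay bounded. *)
Lemma limit_strongly_continuous : strongly_continuous S.
Proof.
move=> f; have [C _ SC] := limit_bounded (wnorm_ge0 f) (ler01 : 0 <= 1 :> R).
have FC : \forall t \near (0 : R)^'+, wball C (S t f).
  near=> t; apply: SC; last exact: lexx.
  by apply/andP; split; near: t; [exact: nbhs_right_ge|exact: nbhs_right_le].
apply: (mixed_cvg_of_bounded (r := C)) => //.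
move=> K e cK e0; have e4 : 0 < e / 4 by rewrite divr_gt0.
have cover x0 : K x0 -> \forall x \near x0 & t \near (0 : R)^'+,
    `|S t f (pt x) - f (pt x)| < e.
  move=> _; have [D D0 DP] := limit_continuous f x0 (lexx 0) e4.
  have S0 : S 0 f = f by exact: (cms_0 limit_cms).
  near=> x t.
  have xD : `|x - x0| < D.
    by near: x; move/cvgr_distC_lt : (@cvg_id _ (nbhs x0)); exact.
  have t_gt0 : 0 < t by near: t; exact: nbhs_right_gt.
  have tD : `|t - 0| < D.
    by rewrite subr0 gtr0_norm//; near: t; exact: nbhs_right_lt.
  have St := DP t x (ltW t_gt0) tD xD.
  have := DP 0 x (lexx 0); rewrite subrr normr0 => /(_ D0 xD).
  rewrite S0 distrC => f0; rewrite S0 in St.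
  rewrite (le_lt_trans (ler_distD (f (pt x0)) _ _))// (le_lt_trans (lerD St f0))//.
  lra.
pose close t x := `|S t f (pt x) - f (pt x)| < e.
have Kclose := (compact_near_coveringP K).1 cK _ _ close _ cover.
suff : \forall t \near (0 : R)^'+, compact_close K e f (S t f) by [].
near=> t; have Kt : K `<=` close t by near: t; exact: Kclose.
by move=> x Kx; rewrite -(ptK x); exact: Kt.
Unshelve. all: by end_near. Qed.

End limit_semigroup.

(** * The generator on the asymptotic domain *)

(** Slopes of the convex function [h |-> S (F + h *: G) y] are nondecreasing: the
    slope on [[0, h]] lies between those on [[-1, 0]] and [[0, 1]]. *)
Lemma convex_increment (R : realType) (d : nat) (kappa : weight R d)
    (Y : set 'rV[R]_d) (S : Ck kappa Y -> Ck kappa Y) (F G : Ck kappa Y) (h : R) y :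
  convex_op S -> 0 < h <= 1 ->
  h * (S F y - S (F - G) y) <= S (F + h *: G) y - S F y <= h * (S (F + G) y - S F y).
Proof.
move=> convS /andP[h0 h1]; apply/andP; split.
  (* [F] is the mean of [F + h *: G] and [F - G] with weights [1] and [h]. *)
  have h10 : 0 < 1 + h by rewrite ltr_wpDr// ltW.
  have l01 : 0 <= (1 + h)^-1 <= 1.
    by rewrite invr_ge0 (ltW h10)/= invf_le1// lerDl ltW.
  have := convS _ (F + h *: G) (F - G) l01 y.
  have -> : (1 + h)^-1 *: (F + h *: G) + (1 - (1 + h)^-1) *: (F - G) = F.
    apply: CkP => z; rewrite !CkE; field; exact: lt0r_neq0.
  set a := S F y; set b := S (F + h *: G) y; set c := S (F - G) y.
  rewrite -(ler_pM2l h10) => H.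
  have E : (1 + h) * ((1 + h)^-1 * b + (1 - (1 + h)^-1) * c) = b + h * c.
    by field; exact: lt0r_neq0.
  rewrite E in H; lra.
have h01 : 0 <= h <= 1 by rewrite (ltW h0).
have := convS h (F + G) F h01 y.
have -> : h *: (F + G) + (1 - h) *: F = F + h *: G.
  by apply: CkP => z; rewrite !CkE; ring.
lra.
Qed.

Section generator.
Context {R : realType} {d : nat} {kappa : weight R d}.
Variables (X : nat -> set 'rV[R]_d) (T : nat -> set R).
Variable (S_ : forall n, R -> Ck kappa (X n) -> Ck kappa (X n)).
Arguments S_ : clear implicits.
Hypothesis sys : stable_system T S_.
Local Notation near_at := (@samples_at _ _ X T).
Local Existing Instance samples_at_filter.
Implicit Types (t r e : R) (x : 'rV[R]_d).

Lemma samples_seq (F : sample X T -> R) (l t : R) x (p_ : nat -> sample X T) :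
  F p @[p --> near_at t x] --> l -> (forall n, ix (p_ n) = n) ->
  tm (p_ n) @[n --> \oo] --> t -> set_val (sp (p_ n)) @[n --> \oo] --> x ->
  F (p_ n) @[n --> \oo] --> l.
Proof.
move=> Fl ixp tmp spp; apply/cvgrPdist_lt => e e0.
move/cvgrPdist_lt : Fl => /(_ _ e0)[D D0 [N DN]].
move/cvgrPdistC_lt : tmp => /(_ _ D0) tD.
move/cvgrPdistC_lt : spp => /(_ _ D0) xD.
near=> n; apply: DN.
- by rewrite ixp; near: n; exact: nbhs_infty_ge.
- by near: n; exact: tD.
- by near: n; exact: xD.
Unshelve. all: by end_near. Qed.

(** With [G] the difference quotient for the step [h], the semigroup law turns
    [S (h k) F - F] into the sum over [i < k] of the increments
    [S (h i) (F + h G) - S (h i) F]. By convexity each of them is [h] times a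
    number between [S F - S (F - G)] and [S (F + G) - S F] at time [h i], and the
    hypotheses say that both are [a] up to [e]. *)
Lemma step_increments n (F : Ck kappa (X n)) (h a e D : R) (y : X n) :
  T n h -> 0 < h <= 1 ->
  (forall s, T n s -> s < D ->
    `|S_ n s (F + diff_quot (S_ n) h F) y - S_ n s F y - a| <= e) ->
  (forall s, T n s -> s < D ->
    `|S_ n s (F - diff_quot (S_ n) h F) y - S_ n s F y + a| <= e) ->
  forall k, h *+ k < D -> T n (h *+ k) /\
    `|S_ n (h *+ k) F y - F y - h *+ k * a| <= h *+ k * e.
Proof.
move=> Th h01 up low; have /andP[h0 h1] := h01.
elim=> [|k IH] kD.
  rewrite mulr0n; split; first exact: sys_T0 sys n.
  by rewrite (cms_0 (sys_semigroup sys n)) subrr !mul0r subrr normr0.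
have kD' : h *+ k < D by rewrite (le_lt_trans _ kD)// mulrS lerDr ltW.
have [Tk Hk] := IH kD'; rewrite mulrSr.
have Tk1 : T n (h *+ k + h) by exact: (cms_timeD (sys_semigroup sys n)).
split => //; rewrite (cms_D (sys_semigroup sys n))//.
have -> : S_ n h F = F + h *: diff_quot (S_ n) h F.
  by rewrite scalerA divff ?gt_eqF// scale1r addrC subrK.
have := convex_increment F (diff_quot (S_ n) h F) y (cms_convex (sys_semigroup sys n) Tk) h01.
have := up _ Tk kD'; have := low _ Tk kD'.
set A := S_ n _ (F + diff_quot _ _ _) y; set B := S_ n _ (F - diff_quot _ _ _) y.
set E := S_ n _ (F + h *: _) y; move: Hk; set C := S_ n _ F y.
rewrite !ler_norml => /andP[C1 C2] /andP[B1 B2] /andP[A1 A2] /andP[E1 E2].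
rewrite !mulrDl; apply/andP; split; nra.
Qed.

Variable S : R -> Ck kappa setT -> Ck kappa setT.
Hypothesis S_lim : forall (f : Ck kappa setT) t x, 0 <= t ->
  S_ (ix p) (tm p) (restr (X (ix p)) f) (sp p) @[p --> near_at t x]
    --> S t f (pt x).
Implicit Types (f g : Ck kappa setT).

(** Near time [0] the approximating semigroups act almost trivially, so they
    transform the increment [G_] of the initial value into [g], the limit of [G_]
    on the compact set [K] that compact continuity assigns to the point [x]. *)
Lemma perturbed_samples (f_ G_ : forall n, Ck kappa (X n)) f g x (r e c : R) K :
  0 < e -> 0 <= c -> compact K ->
  (\forall p \near near_at 0 x, forall u v, wball r u -> wball r v ->
      `|S_ (ix p) (tm p) u (sp p) - S_ (ix p) (tm p) v (sp p)|
        <= c * unorm K (u - v) + e) ->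
  Ck_cvg f_ f -> (forall n, wball r (f_ n + G_ n)) -> wball r (f + g) ->
  unorm K (G_ n - restr (X n) g) @[n --> \oo] --> (0 : R) ->
  \forall p \near near_at 0 x,
    `|S_ (ix p) (tm p) (f_ (ix p) + G_ (ix p)) (sp p)
      - S_ (ix p) (tm p) (f_ (ix p)) (sp p) - g (pt x)| <= 4 * e.
Proof.
move=> e0 c0 cK cP ff fGr fgr Gg.
have S0 u : S 0 u = u by exact: (cms_0 (limit_cms sys S_lim)).
have /cvgrPdist_le /(_ _ e0) H1 := @S_lim (f + g) 0 x (lexx 0).
have /cvgrPdist_le /(_ _ e0) H2 := limit_samples (x := x) sys S_lim (lexx 0) ff.
have u1 : unorm K (restr (X (ix p)) f - f_ (ix p)) @[p --> near_at 0 x] --> (0 : R).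
  exact: (samples_along X T 0 x (Ck_cvg_unorm sys ff cK)).
have u2 : unorm K (G_ (ix p) - restr (X (ix p)) g) @[p --> near_at 0 x] --> (0 : R).
  exact: (samples_along X T 0 x Gg).
have cu : c * (unorm K (restr (X (ix p)) f - f_ (ix p)) +
    unorm K (G_ (ix p) - restr (X (ix p)) g)) @[p --> near_at 0 x] --> c * (0 + 0 : R).
  exact: (cvgM (cvg_cst c) (cvgD u1 u2)).
rewrite addr0 mulr0 in cu.
move/cvgr0Pnorm_le : cu => /(_ _ e0) H3.
near=> p.
have p1 : `|S 0 (f + g) (pt x) - S_ (ix p) (tm p) (restr (X (ix p)) (f + g)) (sp p)| <= e.
  by near: p; exact: H1.
have p2 : `|S 0 f (pt x) - S_ (ix p) (tm p) (f_ (ix p)) (sp p)| <= e.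
  by near: p; exact: H2.
have p3 : `|c * (unorm K (restr (X (ix p)) f - f_ (ix p)) +
    unorm K (G_ (ix p) - restr (X (ix p)) g))| <= e.
  by near: p; exact: H3.
have p4 : `|S_ (ix p) (tm p) (f_ (ix p) + G_ (ix p)) (sp p) -
    S_ (ix p) (tm p) (restr (X (ix p)) (f + g)) (sp p)| <= 2 * e.
  apply: le_trans (near cP p _ _ _ (fGr _) (le_trans (wnorm_restr _ _) fgr)) _ => //.
  have -> : 2 * e = e + e by ring.
  rewrite lerD2r; apply: le_trans p3; apply: le_trans (ler_norm _).
  rewrite ler_wpM2l//.
  have -> : f_ (ix p) + G_ (ix p) - restr (X (ix p)) (f + g) =
      - (restr (X (ix p)) f - f_ (ix p)) + (G_ (ix p) - restr (X (ix p)) g).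
    by apply: CkP => z; rewrite !CkE !restrE !CkE; ring.
  by rewrite (le_trans (unormD _ _ cK))// unormN.
move: p1 p2 p4; rewrite !S0 CkE !ler_norml.
set u := S_ _ _ (restr _ _) _; set v := S_ _ _ (f_ _) _; set w := S_ _ _ (_ + _) _.
move=> /andP[? ?] /andP[? ?] /andP[? ?]; apply/andP; split; lra.
Unshelve. all: by end_near. Qed.

Lemma sys_T_mulrn n (h : R) k : T n h -> T n (h *+ k).
Proof.
move=> Th; elim: k => [|k IH]; first exact: sys_T0 sys n.
by rewrite mulrSr; exact: (cms_timeD (sys_semigroup sys n)).
Qed.

(** First-order expansion of the limit semigroup at time [0]. The step sizes
    [h_ n] are chosen for the compact set [K] that compact continuity assigns to
    the point [x]; [step_increments] then applies to [k n] steps, with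
    [h_ n *+ k n] tending to [h], and the estimate passes to the limit. *)
Lemma asymptotic_expansion f g (f_ : forall n, Ck kappa (X n)) (t_ : nat -> R) x e :
  asymptotic_witness T S_ f g f_ t_ -> 0 < e ->
  exists2 D : R, 0 < D & forall h y, 0 < h < D -> `|y - x| < D ->
    `|S h f (pt y) - f (pt y) - h * g (pt x)| <= h * e.
Proof.
move=> [ff [Tt [M tM] [C fC]] wit] e0.
have [[B fB] _] := ff.
have e4 : 0 < e / 4 by rewrite divr_gt0.
pose r := Num.max (B + C) (wnorm f + wnorm g).
have r0 : 0 <= r by rewrite le_max orbC addr_ge0 ?wnorm_ge0.
have [c [K [c0 cK cP]]] := samples_compact sys x r0 (lexx 0) e4.
have [h_ [hT h_0 Gg]] := wit K cK.
pose G_ n := diff_quot (S_ n) (h_ n) (f_ n).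
have GC n : wnorm (G_ n) <= C by apply: fC; have [] := hT n.
have Gg' : unorm K (- G_ n - restr (X n) (- g)) @[n --> \oo] --> (0 : R).
  rewrite (_ : (fun n => _) = fun n => unorm K (G_ n - restr (X n) g))//.
  apply/funext => n; rewrite -unormN; congr unorm.
  by apply: CkP => z; rewrite !CkE !restrE !CkE; ring.
have H1 := perturbed_samples (G_ := G_) (g := g) e4 c0 cK cP ff _ _ Gg.
have H2 := perturbed_samples (G_ := fun n => - G_ n) (g := - g) e4 c0 cK cP ff _ _ Gg'.
have fG n : wball r (f_ n + G_ n).
  by rewrite /wball /= le_max (le_trans (wnormD _ _))// lerD.
have fG' n : wball r (f_ n - G_ n).
  by rewrite /wball /= le_max (le_trans (wnormB _ _))// lerD.
have fg : wball r (f + g) by rewrite /wball /= le_max wnormD orbT.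
have fg' : wball r (f - g) by rewrite /wball /= le_max wnormB orbT.
have [D D0 [N DN]] := filterI (H1 fG fg) (H2 fG' fg').
exists D => // h y /andP[h0 hD] yD.
have [x_ Xx x_y] := sys_space_approx sys y.
(* The largest multiple of [h_ n] below [h]. *)
pose k n := Num.truncn (h / h_ n); pose s n := h_ n *+ k n.
have h_gt0 n : 0 < h_ n by have [_ /andP[]] := hT n.
have sh n : s n <= h.
  rewrite /s -mulr_natl -ler_pdivlMr// truncn_le//.
  by rewrite divr_ge0// ltW.
have hs n : h - h_ n <= s n.
  rewrite lerBlDr /s -mulrSr -mulr_natl -ler_pdivrMr//.
  by apply/ltW; exact: truncnS_gt.
have s_h : s n @[n --> \oo] --> h.
  apply: (@squeeze_cvgr _ _ _ _ (fun n => h - h_ n) (fun=> h)).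
  - by apply: nearW => n; rewrite hs sh.
  - by rewrite -[X in _ --> X](subr0 h); apply: cvgB => //; exact: cvg_cst.
  - exact: cvg_cst.
have Ts n : T n (s n) by apply: sys_T_mulrn; have [] := hT n.
pose p_ n : sample X T := Sample (SigSub (mem_set (Xx n))) (Ts n).
have lim1 := samples_seq (limit_samples (x := y) sys S_lim (ltW h0) ff)
  (fun n => erefl : ix (p_ n) = n) s_h x_y.
have lim2 := samples_seq (samples_cvg sys (x := y) h ff)
  (fun n => erefl : ix (p_ n) = n) s_h x_y.
rewrite -subr_ge0.
apply: (cvgr_to_ge (cvgB (cvgM s_h (cvg_cst e)) (cvg_norm
  (cvgB (cvgB lim1 lim2) (cvgM s_h (cvg_cst (g (pt x)))))))).
move/cvgrPdistC_lt : h_0 => /(_ _ ltr01) h_1.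
move/cvgrPdistC_lt : x_y => xy.
have Dy : 0 < D - `|y - x| by rewrite subr_gt0.
have {}xy := xy _ Dy.
near=> n; rewrite subr_ge0 /=.
have Nn : (N <= n)%N by near: n; exact: nbhs_infty_ge.
have h1 : 0 < h_ n <= 1.
  rewrite h_gt0 /=; have : `|h_ n - 0| < 1 by near: n; exact: h_1.
  by rewrite subr0 gtr0_norm// => /ltW.
have xD : `|x_ n - x| < D.
  have : `|x_ n - y| < D - `|y - x| by near: n; exact: xy.
  by rewrite ltrBrDr; apply: le_lt_trans; exact: ler_distD.
have e44 : e = 4 * (e / 4) by rewrite mulrC divfK.
have sD t : T n t -> t < D -> `|t - 0| < D.
  by move=> Tt' tD; rewrite subr0 ger0_norm// (sys_T_ge0 sys Tt').
have Thn : T n (h_ n) by have [] := hT n.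
have up t : T n t -> t < D ->
    `|S_ n t (f_ n + G_ n) (sp (p_ n)) - S_ n t (f_ n) (sp (p_ n)) - g (pt x)| <= e.
  move=> Tt' tD.
  by have [] := DN (Sample (sp (p_ n)) Tt') Nn (sD _ Tt' tD) xD; rewrite -e44.
have low t : T n t -> t < D ->
    `|S_ n t (f_ n - G_ n) (sp (p_ n)) - S_ n t (f_ n) (sp (p_ n)) + g (pt x)| <= e.
  move=> Tt' tD.
  have [_] := DN (Sample (sp (p_ n)) Tt') Nn (sD _ Tt' tD) xD.
  by rewrite -e44 CkE opprK.
have := step_increments Thn h1 up low (k := k n).
by move=> /(_ (le_lt_trans (sh n) hD))[].
Unshelve. all: by end_near. Qed.

(** The expansion gives locally uniform convergence of the difference quotients,
    and the rate of the approximating functions bounds them. *)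
Lemma asymptotic_generator f g (f_ : forall n, Ck kappa (X n)) (t_ : nat -> R) :
  asymptotic_witness T S_ f g f_ t_ ->
  diff_quot S h f @[h --> (0 : R)^'+] --> g.
Proof.
move=> wit; have [ff rate _] := wit.
have [[B fB] _] := ff.
have [L L0 LP] := rate_extends sys rate fB (ler0n R 2).
have bnd : \forall h \near (0 : R)^'+, wball L (diff_quot S h f).
  near=> h.
  have h0 : 0 < h by near: h; exact: nbhs_right_gt.
  have h1 : h <= 1 by near: h; exact: nbhs_right_le.
  apply: wnorm_le => // y; rewrite -(ptK y); set x := set_val y.
  rewrite CkE normrM gtr0_norm ?invr_gt0// -mulrA ler_pdivrMl//.
  have lim1 : S_ (ix p) (tm p) (f_ (ix p)) (sp p) - f_ (ix p) (sp p)
      @[p --> near_at h x] --> S h f (pt x) - f (pt x).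
    exact: (cvgB (limit_samples (x := x) sys S_lim (ltW h0) ff)
      (samples_cvg sys (x := x) h ff)).
  rewrite [leRHS]mulrC.
  have lim2 : L * tm p @[p --> near_at h x] --> L * h.
    exact: (cvgM (cvg_cst L) (samples_tm X T x)).
  apply: (samples_weighted_le sys (ltW h0) lim1 lim2).
  have H := samples_tm_le sys x (ltW h0).
  apply: filterS H => p /andP[p0 ph].
  apply: le_trans (wnorm_ub (_ - _) (sp p)) (LP _ _ (tmP p) _).
  by apply: le_trans ph _; lra.
apply: (mixed_cvg_of_bounded (r := L)) => // K e cK e0.
have e4 : 0 < e / 4 by rewrite divr_gt0.
pose close h x := `|diff_quot S h f (pt x) - g (pt x)| < e.
have cover x0 : K x0 -> \forall x \near x0 & h \near (0 : R)^'+, close h x.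
  move=> _; have [D D0 DP] := asymptotic_expansion x0 wit e4.
  near=> x h.
  have xD : `|x - x0| < D.
    by near: x; move/cvgr_distC_lt : (@cvg_id _ (nbhs x0)); exact.
  have gx : `|g (pt x) - g (pt x0)| < e / 4.
    by near: x; move/cvgr_distC_lt : (@Ck_continuous _ _ _ g x0); exact.
  have h0 : 0 < h by near: h; exact: nbhs_right_gt.
  have hD : h < D by near: h; exact: nbhs_right_lt.
  have h0D : 0 < h < D by rewrite h0.
  have := DP h x h0D xD.
  rewrite -ler_pdivrMl// -[X in X * _](gtr0_norm (_ : 0 < h^-1)) ?invr_gt0//.
  rewrite -normrM => H; rewrite /close (le_lt_trans (ler_distD (g (pt x0)) _ _))//.
  have -> : diff_quot S h f (pt x) - g (pt x0) =
      h^-1 * (S h f (pt x) - f (pt x) - h * g (pt x0)).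
    by rewrite !CkE; field; exact: lt0r_neq0.
  rewrite [X in _ + X]distrC (le_lt_trans (lerD H (ltW gx)))//; lra.
have Kclose := (compact_near_coveringP K).1 cK _ _ close _ cover.
suff : \forall h \near (0 : R)^'+, compact_close K e g (diff_quot S h f) by [].
near=> t; have Kt : K `<=` close t by near: t; exact: Kclose.
by move=> x Kx; rewrite -(ptK x); exact: Kt.
Unshelve. all: by end_near. Qed.

End generator.

(** * Existence of the limit along dense data *)

Section row_vectors.
Context {R : realType} {d : nat}.

Lemma rV_rat_dense (x : 'rV[R]_d) (e : R) : 0 < e ->
  exists v : 'rV[rat]_d, `|map_mx ratr v - x| < e.
Proof.
move=> e0.
have /choice[q qP] : forall i, exists q : rat, `|ratr q - x ord0 i| < e.
  move=> i; have [|q] := @rat_in_itvoo R (x ord0 i) (x ord0 i + e).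
    by rewrite ltrDl.
  rewrite in_itv /= => /andP[q1 q2]; exists q.
  by rewrite gtr0_norm ?subr_gt0// ltrBlDl.
exists (\row_i q i).
suff : ball (map_mx ratr (\row_i q i) : 'rV[R]_d) e x by rewrite mx_norm_ball.
by split => // i j; rewrite !mxE /ball /= (ord1 i).
Qed.

Lemma enorm_le (x : 'rV[R]_d) : enorm x <= d.+1%:R * `|x|.
Proof.
have xi i : `|x ord0 i| <= `|x|.
  rewrite [leRHS]/Num.norm /= mx_normrE.
  exact: (le_bigmax _ (fun ij => `|x ij.1 ij.2|) (ord0, i)).
rewrite /enorm -[leRHS]ger0_norm ?mulr_ge0// -sqrtr_sqr ler_sqrt ?sqr_ge0//.
apply: (@le_trans _ _ (\sum_(i < d) `|x| ^+ 2)).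
  apply: ler_sum => i _.
  by rewrite -[leLHS]ger0_norm ?sqr_ge0// normrX ler_pXn2r ?nnegrE.
rewrite sumr_const card_ord exprMn -[leLHS]mulr_natl ler_wpM2r ?sqr_ge0//.
by rewrite -natrX ler_nat (leq_trans (leqnSn d))// leq_pmulr.
Qed.

End row_vectors.

Section limit_existence.
Context {R : realType} {d : nat} {kappa : weight R d}.
Variables (X : nat -> set 'rV[R]_d) (T : nat -> set R).
Variable (S_ : forall n, R -> Ck kappa (X n) -> Ck kappa (X n)).
Arguments S_ : clear implicits.
Hypothesis sys : stable_system T S_.
Local Notation near_at := (@samples_at _ _ X T).
Local Existing Instance samples_at_filter.
Implicit Types (t r e : R) (x : 'rV[R]_d) (f g : Ck kappa setT).

(** The pointwise limits depend continuously on the point and inherit the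
    weighted bound of the approximations, so they form a function of the space. *)
Lemma limit_exists :
  (forall f t x, 0 <= t -> cvg (S_ (ix p) (tm p) (restr (X (ix p)) f) (sp p)
     @[p --> near_at t x])) ->
  exists S : R -> Ck kappa setT -> Ck kappa setT, forall f t x, 0 <= t ->
    S_ (ix p) (tm p) (restr (X (ix p)) f) (sp p) @[p --> near_at t x]
      --> S t f (pt x).
Proof.
move=> clim.
pose u f t x : R := lim (S_ (ix p) (tm p) (restr (X (ix p)) f) (sp p)
     @[p --> near_at t x]).
have uP f t x : 0 <= t -> S_ (ix p) (tm p) (restr (X (ix p)) f) (sp p)
     @[p --> near_at t x] --> u f t x by move=> t0; exact: clim.
have /choice[S SP] : forall tf : R * Ck kappa setT, exists h : Ck kappa setT,
    0 <= tf.1 -> forall x, h (pt x) = u tf.2 tf.1 x.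
  move=> [t f] /=; have [t0|_] := leP 0 t; last by exists 0.
  have [||h hP] := @Ck_build _ _ kappa (u f t).
  - move=> x; apply/(@cvgrPdistC_le _ _ _ (nbhs x)) => e e0.
    have [D D0 DP] := samples_lim_continuous sys (uP f) x t0 e0.
    have xD : \forall y \near x, `|y - x| < D.
      by apply/nbhs_normP; exists D => // y; rewrite /= distrC.
    apply: filterS xD => y yD; apply: DP => //; by rewrite subrr normr0.
  - have t10 : 0 <= t + 1 by rewrite addr_ge0.
    have [C C0 SC] := sys_bounded sys (wnorm_ge0 f) t10; exists C => x.
    apply: (samples_weighted_le sys t0 (@uP f t x t0) (cvg_cst C)).
    have H := samples_tm_le sys x t0; apply: filterS H => p /andP[p0 pt1].
    apply: le_trans (wnorm_ub _ (sp p)) _; apply: SC (tmP p) pt1 _.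
    exact: wnorm_restr.
  by exists h.
exists (fun t f => S (t, f)) => f t x t0.
rewrite (SP (t, f) t0); exact: uP.
Unshelve. all: by end_near. Qed.

Variable xs : 'rV[rat]_d -> forall n, X n.
Hypothesis xsP : forall v, set_val (xs v n) @[n --> \oo] --> (map_mx ratr v : 'rV[R]_d).

(** The data from which the limit is constructed: hypothesis (3) at [f], together
    with the convergence at countably many places that is arranged by passing to a
    subsequence. *)
Definition anchored (Q : set R) f (f_ : forall n, Ck kappa (X n)) :=
  [/\ Ck_cvg f_ f, forall n, wnorm (f_ n) <= wnorm f,
      exists t_ : nat -> R, bounded_rate T S_ f_ t_
    & forall q, Q q -> exists q_ : nat -> R,
      [/\ forall n, T n (q_ n), q_ n @[n --> \oo] --> q,
          uniformly_equicontinuous (fun n => S_ n (q_ n) (f_ n))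
        & forall v, cvg (S_ n (q_ n) (f_ n) (xs v n) @[n --> \oo])]].

(** Images at time [s] near [t] and at a point near [x] are compared with the image
    at a time of [Q], by the rate, and then with its value at a nearby [xs v], by
    equicontinuity; these reference values converge. *)
Lemma anchored_cvg (Q : set R) f (f_ : forall n, Ck kappa (X n)) t x :
  Q `<=` [set t : R | 0 <= t] -> [set t : R | 0 <= t] `<=` closure Q ->
  anchored Q f f_ -> 0 <= t ->
  cvg (S_ (ix p) (tm p) (f_ (ix p)) (sp p) @[p --> near_at t x]).
Proof.
move=> Q0 Qd [_ fr [t_ rate] anch] t0.
have PF := samples_at_proper sys x t0.
apply: cauchy_cvg; apply: cauchy_exP => e e0.
have e4 : 0 < e / 4 by rewrite divr_gt0.
have t20 : 0 <= t + 2 by rewrite addr_ge0.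
have [L L0 LP] := rate_lipschitz sys rate fr t20.
have cK : compact (cball (`|x| + 1) : set 'rV[R]_d) by exact: cball_compact.
have [m m0 mP] := weight_lb (kappa := kappa) cK.
(* Times within [3 * eta] of each other change the value by at most [e / 4]. *)
pose eta := Num.min 1 (e / 4 * m / (3 * (L + 1))).
have L1 : 0 < 3 * (L + 1) by rewrite mulr_gt0// ltr_wpDl.
have eta0 : 0 < eta by rewrite lt_min ltr01 !mulr_gt0// ?invr_gt0.
have [q [Qq qt]] := Qd t t0 _ (nbhsx_ballx t eta eta0).
have {}qt : `|t - q| < eta by [].
have [q_ [Tq q_q equi qcvg]] := anch q Qq.
have [D D0 DP] := equi _ e4.
(* A maximum norm below [3 * D'] forces a Euclidean norm below [D]. *)
pose D' := D / (3 * d.+1%:R).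
have D'0 : 0 < D' by rewrite divr_gt0// mulr_gt0.
have [v vx] := rV_rat_dense x D'0.
have /cvg_ex[/= z zP] := qcvg v.
exists z.
have H1 : \forall n \near \oo, `|q - q_ n| < eta by move/cvgrPdist_lt : q_q; exact.
have H2 : \forall n \near \oo, `|set_val (xs v n) - map_mx ratr v| < D'.
  by move/cvgrPdistC_lt : (@xsP v); exact.
have H3 : \forall n \near \oo, `|z - S_ n (q_ n) (f_ n) (xs v n)| < e / 4.
  by move/cvgrPdist_lt : zP; exact.
have B1 := samples_ix X T t x H1.
have B2 := samples_ix X T t x H2.
have B3 := samples_ix X T t x H3.
have B4 := samples_cball X T t x.
have B5 : \forall p \near near_at t x, `|tm p - t| < eta.
  by move/cvgrPdistC_lt : (@samples_tm _ _ X T t x); exact.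
have B6 : \forall p \near near_at t x, `|set_val (sp p) - x| < D'.
  by move/cvgrPdistC_lt : (@samples_sp _ _ X T t x); exact.
near=> p.
have b1 : `|q - q_ (ix p)| < eta by near: p; exact: B1.
have b2 : `|set_val (xs v (ix p)) - map_mx ratr v| < D' by near: p; exact: B2.
have b3 : `|z - S_ (ix p) (q_ (ix p)) (f_ (ix p)) (xs v (ix p))| < e / 4.
  by near: p; exact: B3.
have b4 : cball (`|x| + 1) (set_val (sp p)) by near: p; exact: B4.
have b5 : `|tm p - t| < eta by near: p; exact: B5.
have b6 : `|set_val (sp p) - x| < D' by near: p; exact: B6.
have eta1 : eta <= 1 by rewrite ge_min lexx.
have tq : `|tm p - q_ (ix p)| <= 3 * eta.
  rewrite (le_trans (ler_distD t _ _))//.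
  have := ler_distD q t (q_ (ix p)); lra.
have c1 : `|S_ (ix p) (tm p) (f_ (ix p)) (sp p) -
    S_ (ix p) (q_ (ix p)) (f_ (ix p)) (sp p)| <= e / 4.
  rewrite -CkBE; apply: le_trans (wnorm_pt _ _) _.
  rewrite ler_pdivrMr ?weight_gt0//.
  apply: (@le_trans _ _ (e / 4 * m)); last by rewrite ler_wpM2l ?(ltW e4)//; exact: mP.
  apply: le_trans (LP _ _ _ (tmP p) (Tq _) _ _) _.
  - move: b5; rewrite ltr_norml => /andP[_]; lra.
  - move: b1 qt; rewrite !ltr_norml => /andP[? ?] /andP[? ?]; lra.
  apply: (@le_trans _ _ ((L + 1) * (3 * eta))).
    by apply: ler_pM => //; rewrite lerDl.
  have : eta <= e / 4 * m / (3 * (L + 1)) by rewrite ge_min lexx orbT.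
  rewrite ler_pdivlMr//.
  by have -> : (L + 1) * (3 * eta) = eta * (3 * (L + 1)) by ring.
have c2 : `|S_ (ix p) (q_ (ix p)) (f_ (ix p)) (sp p) -
    S_ (ix p) (q_ (ix p)) (f_ (ix p)) (xs v (ix p))| < e / 4.
  apply: DP; apply: le_lt_trans (enorm_le _) _.
  rewrite mulrC -ltr_pdivlMr//.
  rewrite (le_lt_trans (ler_distD x _ _))//.
  have := ler_distD (map_mx ratr v) x (set_val (xs v (ix p))).
  rewrite distrC in vx; rewrite distrC in b2.
  have -> : D / d.+1%:R = 3 * D'.
    have : (d.+1%:R : R) != 0 by rewrite pnatr_eq0.
    by rewrite /D'; move: (d.+1%:R : R) => a a0; field.
  lra.
rewrite /= /ball /= distrC.
apply: le_lt_trans (ler_distD (S_ (ix p) (q_ (ix p)) (f_ (ix p)) (sp p)) _ _) _.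
have := ler_distD (S_ (ix p) (q_ (ix p)) (f_ (ix p)) (xs v (ix p)))
  (S_ (ix p) (q_ (ix p)) (f_ (ix p)) (sp p)) z.
rewrite distrC in b3; lra.
Unshelve. all: by end_near. Qed.

(** Compact continuity is uniform in [n], so a function of [D0] that is close to
    [f] on a large compact set has images close to those of [f]. *)
Lemma anchored_dense_cvg (Q : set R) (D0 : set (Ck kappa setT)) :
  Q `<=` [set t : R | 0 <= t] -> [set t : R | 0 <= t] `<=` closure Q ->
  (forall f, D0 f -> exists f_ : forall n, Ck kappa (X n), anchored Q f f_) ->
  (forall f, exists f_ : nat -> Ck kappa setT,
     [/\ forall n, D0 (f_ n), f_ n @[n --> \oo] --> f
       & forall n, wnorm (f_ n) <= wnorm f]) ->
  forall f t x, 0 <= t ->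
    cvg (S_ (ix p) (tm p) (restr (X (ix p)) f) (sp p) @[p --> near_at t x]).
Proof.
move=> Q0 Qd anch appr f t x t0.
have PF := samples_at_proper sys x t0.
apply: cauchy_cvg; apply: cauchy_exP => e e0.
have e5 : 0 < e / 5 by rewrite divr_gt0.
have [c [K [c0 cK cP]]] := samples_compact sys x (wnorm_ge0 f) t0 e5.
have [f_ [f_D f_f f_le]] := appr f.
have ce : 0 < e / 5 / (c + 1) by rewrite divr_gt0// ltr_wpDl.
have [k kP] : exists k, compact_close K (e / 5 / (c + 1)) f (f_ k).
  by apply: (@filter_ex _ \oo); apply: f_f; exact: nbhs_mixed_compact.
set g := f_ k; have [g_ ag] := anch g (f_D k).
have [gg g_le _ _] := ag.
have /cvg_ex[/= z zP] := @anchored_cvg Q g g_ t x Q0 Qd ag t0.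
exists z.
have B1 : \forall p \near near_at t x,
    `|z - S_ (ix p) (tm p) (g_ (ix p)) (sp p)| <= e / 5.
  by move/cvgrPdist_le : zP; exact.
have B2 := samples_along X T t x (Ck_cvg_unorm sys gg cK).
move/cvgr0Pnorm_le : B2 => /(_ _ ce) B2.
near=> p.
have b1 : `|z - S_ (ix p) (tm p) (g_ (ix p)) (sp p)| <= e / 5 by near: p; exact: B1.
have b2 : `|unorm K (restr (X (ix p)) g - g_ (ix p))| <= e / 5 / (c + 1).
  by near: p; exact: B2.
have fgk : unorm K (restr (X (ix p)) f - g_ (ix p)) <= 2 * (e / 5 / (c + 1)).
  rewrite -[_ - _](subrKA (restr (X (ix p)) g)) (le_trans (unormD _ _ cK))//.
  have -> : 2 * (e / 5 / (c + 1)) = e / 5 / (c + 1) + e / 5 / (c + 1) by ring.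
  apply: lerD; last exact: le_trans (ler_norm _) b2.
  apply: unorm_le => [|y Ky]; first exact: ltW.
  by rewrite !CkE !restrE distrC; apply/ltW/kP.
have b3 : `|S_ (ix p) (tm p) (restr (X (ix p)) f) (sp p) -
    S_ (ix p) (tm p) (g_ (ix p)) (sp p)| <= 3 * (e / 5).
  apply: le_trans (near cP p _ _ _ _ _) _ => //.
  - exact: wnorm_restr.
  - exact: le_trans (g_le _) (f_le _).
  have -> : 3 * (e / 5) = 2 * (e / 5) + e / 5 by ring.
  rewrite lerD2r; apply: le_trans (ler_wpM2l c0 fgk) _.
  rewrite mulrCA ler_wpM2l// mulrCA ler_piMr ?(ltW e5)//.
  by rewrite ler_pdivrMr ?ltr_wpDl// mul1r lerDl.
rewrite /= /ball /=.
apply: le_lt_trans (ler_distD (S_ (ix p) (tm p) (g_ (ix p)) (sp p)) _ _) _.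
rewrite distrC in b3; lra.
Unshelve. all: by end_near. Qed.

End limit_existence.

(** * Diagonal subsequences *)

Section subsequences.
Context {R : realType}.

(** The values cluster at some [b] in the compact interval [[- C, C]]. Without
    convergence to [b], the ultrafilter would contain the indices of the values
    outside some neighbourhood of [b], against clustering. *)
Lemma ultrafilter_limit (U : set_system nat) (u : nat -> R) (C : R) :
  UltraFilter U -> (forall n, `|u n| <= C) -> exists b : R, u n @[n --> U] --> b.
Proof.
move=> UU uC; have PU := @ultra_proper _ _ UU.
have [|b [_ ub]] := @segment_compact R (- C) C (u n @[n --> U]) _.
  by apply: (@filterE _ U) => n /=; rewrite in_itv /= -ler_norml.
exists b; apply/cvgrPdistC_lt => e e0.
have [//|Uc] := in_ultra_setVsetC [set n | `|u n - b| < e] UU.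
have [z [/= z1 z2]] := ub (~` [set y | `|y - b| < e]) (ball b e) Uc (nbhsx_ballx b e e0).
by case: z1; rewrite distrC.
Qed.

(** Along a nonprincipal ultrafilter every [a k] has a limit, and the indices at
    which [a 0, ..., a l] are all within [harmonic l] of their limits form a set
    of the ultrafilter, which is therefore unbounded; [nu l] is taken in it. *)
Lemma diagonal_nat (a : nat -> nat -> R) :
  (forall k, exists C, forall n, `|a k n| <= C) ->
  exists nu : nat -> nat, {homo nu : l m / (l < m)%N} /\
    forall k, cvg (a k (nu l) @[l --> \oo]).
Proof.
move=> ab.
have [U [UU ooU]] := ultraFilterLemma (F := \oo) _.
have PU := @ultra_proper _ _ UU.
have /choice[b bP] : forall k, exists b : R, a k n @[n --> U] --> b.
  by move=> k; have [C aC] := ab k; exact: ultrafilter_limit aC.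
pose good l := [set n | forall k, (k <= l)%N -> `|a k n - b k| < harmonic l].
have goodU l : U (good l).
  have : forall m, U [set n | forall k, (k <= m)%N -> `|a k n - b k| < harmonic l].
    elim=> [|m IH].
      have /cvgrPdistC_lt /(_ _ (harmonic_gt0 l)) H := bP 0%N.
      by apply: filterS H => n ? k; rewrite leqn0 => /eqP->.
    have /cvgrPdistC_lt /(_ _ (harmonic_gt0 l)) H := bP m.+1.
    apply: filterS (filterI IH H) => n [n1 n2] k.
    by rewrite leq_eqVlt ltnS => /orP[/eqP->|/n1].
  by move=> /(_ l).
have /choice[s sP] : forall lN : nat * nat, exists n, (lN.2 < n)%N /\ good lN.1 n.
  move=> [l N] /=; apply: (@filter_ex _ U _ [set n | (N < n)%N /\ good l n]).
  have UN : U [set n | (N < n)%N] by apply: ooU; exact: nbhs_infty_gt.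
  exact: filterI UN (goodU l).
pose nu := fix nu l := if l is l'.+1 then s (l, nu l') else s (0%N, 0%N).
have nu_good l : good l (nu l).
  by case: l => [|l]; [case: (sP (0%N, 0%N))|case: (sP (l.+1, nu l))].
exists nu; split.
  by apply: homo_ltn => [? ? ?|l]; [exact: ltn_trans|case: (sP (l.+1, nu l))].
move=> k; apply/cvg_ex; exists (b k); apply/cvgrPdistC_lt => e e0.
have /cvgrPdistC_lt /(_ _ e0) h0 := @cvg_harmonic R.
near=> l; apply: (@lt_trans _ _ (harmonic l)).
  by apply: nu_good; near: l; exact: nbhs_infty_ge.
have : `|harmonic l - 0| < e by near: l; exact: h0.
by rewrite subr0; apply: le_lt_trans; exact: ler_norm.
Unshelve. all: by end_near. Qed.

Lemma diagonal_subsequence (A : Type) (I : set A) (a : A -> nat -> R) :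
  countable I -> (forall i, I i -> exists C, forall n, `|a i n| <= C) ->
  exists nu : nat -> nat, {homo nu : l m / (l < m)%N} /\
    forall i, I i -> cvg (a i (nu l) @[l --> \oo]).
Proof.
move=> /countable_injP[code codeI] ab.
have /choice[a' a'P] : forall k, exists u : nat -> R,
    (exists C, forall n, `|u n| <= C) /\ forall i, I i -> code i = k -> u = a i.
  move=> k; have [[i [Ii ik]]|no] := pselect (exists i, I i /\ code i = k).
    exists (a i); split; first exact: ab.
    by move=> j Ij jk; congr a; apply: codeI; rewrite ?inE// ik.
  exists (fun=> 0); split; first by exists 0 => n; rewrite normr0.
  by move=> i Ii ik; case: no; exists i.
have [nu [nu_mono nuP]] := diagonal_nat (fun k => (a'P k).1).
exists nu; split => // i Ii.
by have := nuP (code i); rewrite ((a'P _).2 i Ii erefl).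
Qed.

Lemma increasing_infty (nu : nat -> nat) :
  {homo nu : l m / (l < m)%N} -> nu l @[l --> \oo] --> \oo.
Proof.
move=> nu_mono A [N _ NA]; exists N => // l /= Nl; apply: NA => /=.
apply: leq_trans Nl _; elim: l => // l IH; apply: leq_ltn_trans IH _.
exact: nu_mono.
Qed.

Context {d : nat} {kappa : weight R d}.
Variables (X : nat -> set 'rV[R]_d) (T : nat -> set R).
Variable (S_ : forall n, R -> Ck kappa (X n) -> Ck kappa (X n)).
Arguments S_ : clear implicits.
Hypothesis sys : stable_system T S_.
Variable nu : nat -> nat.
Hypothesis nu_mono : {homo nu : l m / (l < m)%N}.

Lemma cvg_along (V : topologicalType) (u : nat -> V) (v : V) :
  u n @[n --> \oo] --> v -> u (nu l) @[l --> \oo] --> v.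
Proof. by move=> uv; apply: cvg_comp uv; exact: increasing_infty. Qed.

Lemma stable_system_along :
  stable_system (fun l => T (nu l)) (fun l => S_ (nu l)).
Proof.
split.
- move=> t t0; have [t_ Tt t_t] := sys_time_approx sys t0.
  by exists (fun l => t_ (nu l)) => //; exact: cvg_along.
- move=> x; have [x_ Xx x_x] := sys_space_approx sys x.
  by exists (fun l => x_ (nu l)) => //; exact: (cvg_along x_x).
- by move=> l; exact: sys_time_addsub sys (nu l).
- by move=> l; exact: sys_semigroup sys (nu l).
- move=> r T0 r0 T00; have [c c0 cP] := sys_lipschitz sys r0 T00.
  by exists c => // l; exact: cP.
- move=> e r T0 K e0 r0 T00 cK.
  have [c [K' [c0 cK' cP]]] := sys_compact sys e0 r0 T00 cK.
  by exists c, K'; split => // l; exact: cP.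
Qed.

Lemma Ck_cvg_along (f_ : forall n, Ck kappa (X n)) (f : Ck kappa setT) :
  Ck_cvg f_ f -> Ck_cvg (fun l => f_ (nu l)) f.
Proof.
move=> ff; split; first by have [[C fC] _] := ff; exists C => l; exact: fC.
by move=> K cK _; exact: (cvg_along (Ck_cvg_unorm sys ff cK)).
Qed.

Lemma bounded_rate_along (f_ : forall n, Ck kappa (X n)) (t_ : nat -> R) :
  bounded_rate T S_ f_ t_ ->
  bounded_rate (fun l => T (nu l)) (fun l => S_ (nu l))
    (fun l => f_ (nu l)) (fun l => t_ (nu l)).
Proof.
move=> [Tt [M tM] [C fC]]; split.
- by move=> l; exact: Tt.
- by exists M => l; exact: tM.
- by exists C => l; exact: fC.
Qed.

Lemma asymptotic_witness_along (f g : Ck kappa setT)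
    (f_ : forall n, Ck kappa (X n)) (t_ : nat -> R) :
  asymptotic_witness T S_ f g f_ t_ ->
  asymptotic_witness (fun l => T (nu l)) (fun l => S_ (nu l)) f g
    (fun l => f_ (nu l)) (fun l => t_ (nu l)).
Proof.
move=> [ff rate wit]; split; [exact: Ck_cvg_along|exact: bounded_rate_along|].
move=> K cK; have [h_ [hT h_0 hg]] := wit K cK.
exists (fun l => h_ (nu l)); split; [by move=> l; exact: hT|exact: cvg_along|].
exact: (cvg_along hg).
Qed.

Lemma samples_bounded (f_ : forall n, Ck kappa (X n)) (r : R) (t_ : nat -> R)
    (x_ : forall n, X n) (t : R) (x : 'rV[R]_d) :
  (forall n, wnorm (f_ n) <= r) -> (forall n, T n (t_ n)) ->
  t_ n @[n --> \oo] --> t -> set_val (x_ n) @[n --> \oo] --> x ->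
  exists C, forall n, `|S_ n (t_ n) (f_ n) (x_ n)| <= C.
Proof.
move=> fr Tt t_t x_x.
have r0 : 0 <= r by exact: le_trans (wnorm_ge0 (f_ 0%N)) (fr 0%N).
have bnd (V : normedModType R) (u : nat -> V) (v : V) :
    u n @[n --> \oo] --> v -> exists2 M, 0 <= M & forall n, `|u n| <= M.
  move=> uv; have /cvg_seq_bounded[M [_ uM]] : cvg (u n @[n --> \oo]).
    by apply/cvg_ex; exists v.
  exists (`|M| + 1); first by rewrite addr_ge0.
  by move=> n; apply: uM => //; rewrite (le_lt_trans (ler_norm M))// ltrDl.
have [M1 M10 tM] := bnd _ _ _ t_t; have [M2 _ xM] := bnd _ _ _ x_x.
have [B B0 SB] := sys_bounded sys r0 M10.
have cK : compact (cball M2 : set 'rV[R]_d) by exact: cball_compact.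
have [m m0 mP] := weight_lb (kappa := kappa) cK.
exists (B / m) => n; apply: le_trans (wnorm_pt _ _) _.
apply: ler_pM; [exact: wnorm_ge0|by rewrite invr_ge0 ltW// weight_gt0| |].
  by apply: SB; [exact: Tt|exact: le_trans (ler_norm _) (tM n)|exact: fr].
by rewrite lef_pV2 ?posrE ?weight_gt0//; exact: mP (xM n).
Qed.

End subsequences.

(** * Convergence of convex monotone semigroups *)

Theorem theorem2p5 (R : realType) (d : nat) (kappa : weight R d)
  (X : nat -> set 'rV[R]_d) (T : nat -> set R)
  (S_ : forall n, R -> Ck kappa (X n) -> Ck kappa (X n))
  (T_ge0 : forall n (t : R), T n t -> 0 <= t)
  (T_approx : forall t : R, 0 <= t -> exists2 t_ : nat -> R,
     forall n, T n (t_ n) & t_ n @[n --> \oo] --> t)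
  (X_approx : forall x : 'rV[R]_d, exists2 x_ : nat -> 'rV[R]_d,
     forall n, X n (x_ n) & x_ n @[n --> \oo] --> x)
  (T_addsub : forall n (s t : R), T n s -> T n t -> t <= s ->
     T n (s + t) /\ T n (s - t))
  (X_closed : forall n, closed (X n))
  (X_add : forall n x y, X n x -> X n y -> X n (x + y))
  (S_semigroup : forall n, convex_monotone_semigroup (T n) (S_ n))
  (H1 : forall r T0 : R, 0 <= r -> 0 <= T0 -> exists2 c : R, 0 <= c &
     forall n t, T n t -> 0 <= t <= T0 ->
     forall f g, wball r f -> wball r g ->
       wnorm (S_ n t f - S_ n t g) <= c * wnorm (f - g))
  (H2 : forall (e r T0 : R) K, 0 < e -> 0 <= r -> 0 <= T0 -> compact K ->
     exists (c : R) K', [/\ 0 <= c, compact K' &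
       forall n t, T n t -> 0 <= t <= T0 ->
       forall f g, wball r f -> wball r g ->
         unorm K (S_ n t f - S_ n t g) <= c * unorm K' (f - g) + e])
  (H3 : exists (D0 : set (Ck kappa setT)) (Q : set R),
     [/\ countable D0 /\ dense D0,
         [/\ countable Q, Q `<=` [set t : R | 0 <= t]
           & [set t : R | 0 <= t] `<=` closure Q],
         forall f, D0 f -> exists fbar : forall n, Ck kappa (X n),
           [/\ Ck_cvg fbar f,
               forall n, wnorm (fbar n) <= wnorm f,
               exists t_ : nat -> R, bounded_rate T S_ fbar t_
             & forall t, Q t -> exists tbar : nat -> R,
                 [/\ forall n, T n (tbar n),
                     tbar n @[n --> \oo] --> t
                   & uniformly_equicontinuous
                       (fun n => S_ n (tbar n) (fbar n))]]
       & forall f, exists f_ : nat -> Ck kappa setT,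
           [/\ forall n, D0 (f_ n),
               f_ n @[n --> \oo] --> f
             & forall n, wnorm (f_ n) <= wnorm f]]) :
  exists (S : R -> Ck kappa setT -> Ck kappa setT) (nu : nat -> nat),
    [/\ convex_monotone_semigroup [set t : R | 0 <= t] S
          /\ strongly_continuous S,
        {homo nu : l m / (l < m)%N}
          /\ (forall (f : Ck kappa setT) (t : R), 0 <= t ->
              forall (t_ : nat -> R) (f_ : forall n, Ck kappa (X n)),
                (forall n, T n (t_ n)) -> t_ n @[n --> \oo] --> t ->
                Ck_cvg f_ f ->
                Ck_cvg (fun l => S_ (nu l) (t_ (nu l)) (f_ (nu l))) (S t f)),
        asymptotic_domain T S_ `<=` generator_dom S
          /\ (forall f g f_ t_, asymptotic_witness T S_ f g f_ t_ ->
              forall K h_, compact K -> rate_sequence T S_ g f_ t_ K h_ ->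
                unorm K (diff_quot (S_ n) (h_ n) (f_ n)
                           - restr (X n) (generator S f))
                  @[n --> \oo] --> (0 : R)),
        forall r T0 : R, 0 <= r -> 0 <= T0 -> exists2 c : R, 0 <= c &
          forall t, 0 <= t <= T0 ->
          forall f g, wball r f -> wball r g ->
            wnorm (S t f - S t g) <= c * wnorm (f - g)
      & forall (e r T0 : R) K, 0 < e -> 0 <= r -> 0 <= T0 -> compact K ->
          exists (c : R) K', [/\ 0 <= c, compact K' &
            forall t, 0 <= t <= T0 ->
            forall f g, wball r f -> wball r g ->
              unorm K (S t f - S t g) <= c * unorm K' (f - g) + e]].
Proof.
have sys : stable_system T S_ by split.
have [D0 [Q [[cD0 _] [cQ Q0 Qd] D0P appr]]] := H3.
have /choice[fb fbP] : forall f, exists fb : forall n, Ck kappa (X n), D0 f ->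
    [/\ Ck_cvg fb f, forall n, wnorm (fb n) <= wnorm f,
        exists t_ : nat -> R, bounded_rate T S_ fb t_
      & forall t, Q t -> exists tbar : nat -> R,
        [/\ forall n, T n (tbar n), tbar n @[n --> \oo] --> t
          & uniformly_equicontinuous (fun n => S_ n (tbar n) (fb n))]].
  move=> f; have [Df|nDf] := pselect (D0 f); first by have [fb] := D0P f Df; exists fb.
  by exists (fun=> 0).
have /choice[tb tbP] : forall ft : Ck kappa setT * R, exists tb : nat -> R,
    D0 ft.1 -> Q ft.2 -> [/\ forall n, T n (tb n), tb n @[n --> \oo] --> ft.2
      & uniformly_equicontinuous (fun n => S_ n (tb n) (fb ft.1 n))].
  move=> [f t] /=; have [[Df Qt]|nDQ] := pselect (D0 f /\ Q t).
    by have [_ _ _ /(_ t Qt)[tb]] := fbP f Df; exists tb.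
  by exists (fun=> 0) => Df Qt; case: nDQ.
have /choice[xs xsP] : forall v : 'rV[rat]_d, exists x_ : forall n, X n,
    set_val (x_ n) @[n --> \oo] --> (map_mx ratr v : 'rV[R]_d).
  move=> v; have [x_ Xx x_v] := X_approx (map_mx ratr v).
  by exists (fun n => SigSub (mem_set (Xx n))).
pose I : set (Ck kappa setT * R * 'rV[rat]_d) := (D0 `*` Q) `*` setT.
pose a (i : Ck kappa setT * R * 'rV[rat]_d) n : R :=
  S_ n (tb i.1 n) (fb i.1.1 n) (xs i.2 n).
have cI : countable I.
  apply: countableX; first exact: countableX.
  by apply/countable_injP; exists pickle => u v _ _; exact: (pcan_inj pickleK).
have [|nu [nu_mono nuP]] := @diagonal_subsequence R _ I a cI.
  move=> [[f t] v] /= [[/= Df Qt] _].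
  have [_ fr _ _] := fbP f Df; have [Tt t_t _] := tbP (f, t) Df Qt.
  exact: (samples_bounded sys fr Tt t_t (xsP v)).
have sys' := stable_system_along sys nu_mono.
have anch f : D0 f -> anchored (fun l => T (nu l)) (fun l => S_ (nu l))
    (fun v l => xs v (nu l)) Q f (fun l => fb f (nu l)).
  move=> Df; have [ff fr [t_ rate] _] := fbP f Df; split.
  - exact: (Ck_cvg_along sys nu_mono ff).
  - by move=> l; exact: fr.
  - by exists (fun l => t_ (nu l)); exact: bounded_rate_along.
  - move=> q Qq; have [Tq q_q equi] := tbP (f, q) Df Qq.
    exists (fun l => tb (f, q) (nu l)); split.
    + by move=> l; exact: Tq.
    + exact: (cvg_along nu_mono q_q).
    + move=> e e0; have [D D_gt0 DP] := equi e e0.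
      by exists D => // l; exact: DP.
    + by move=> v; exact: (nuP (f, q, v)).
have xsP' v : set_val (xs v (nu l)) @[l --> \oo] --> (map_mx ratr v : 'rV[R]_d).
  exact: (cvg_along nu_mono (xsP v)).
have [S S_lim] := limit_exists sys' (anchored_dense_cvg sys' xsP' Q0 Qd
  (fun f Df => ex_intro _ _ (anch f Df)) appr).
have gen f g f_ t_ : asymptotic_witness T S_ f g f_ t_ ->
    diff_quot S h f @[h --> (0 : R)^'+] --> g.
  move=> wit.
  exact: (asymptotic_generator sys' S_lim (asymptotic_witness_along sys nu_mono wit)).
exists S, nu; split.
- split; [exact: (limit_cms sys' S_lim)|exact: (limit_strongly_continuous sys' S_lim)].
- split => // f t t0 t_ f_ Tt t_t ff.
  apply: (limit_Ck_cvg (t_ := fun l => t_ (nu l)) sys' S_lim t0).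
  + by move=> l; exact: Tt.
  + exact: (cvg_along nu_mono t_t).
  + exact: (Ck_cvg_along sys nu_mono ff).
- split=> [f [g [f_ [t_ wit]]]|f g f_ t_ wit K h_ cK [_ _ rate]].
    by apply/cvg_ex; exists g; exact: gen wit.
  have -> : generator S f = g by apply: cvg_lim (gen _ _ _ _ wit); exact: mixed_hausdorff.
  exact: rate.
- by move=> r T0 r0 T00; exact: (limit_lipschitz sys' S_lim r0 T00).
- by move=> e r T0 K e0 r0 T00 cK; exact: (limit_compact sys' S_lim e0 r0 T00 cK).
Qed.
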